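(* Let $\Gamma$ be a finite connected simplicial graph of girth at least $6$. If $N$ is the maximal degree of $\Gamma$, then every loxodromic $g\in A(\Gamma)$ permutes cyclically at most $N$ pairwise disjoint geodesics on $\Gamma^e$; that is, there are an integer $1\le m\le N$ and a collection of $m$ pairwise disjoint bi-infinite geodesics in $\Gamma^e$ that is preserved and cyclically permuted by $g$.
   Context: For a finite connected simplicial graph $\Gamma$, $A(\Gamma)=\langle v\in V(\Gamma)\mid [u,v]=1 \text{ for all } \{u,v\}\in E(\Gamma)\rangle$ is its right-angled Artin group. For $x,h\in A(\Gamma)$ write $x^h=h^{-1}xh$. The extension graph $\Gamma^e$ is the simplicial graph with vertex set $\{v^g\mid v\in V(\Gamma), g\in A(\Gamma)\}\subset A(\Gamma)$, where two distinct vertices are joined by an edge exactly when they commute in $A(\Gamma)$. It carries the edge metric $d_{\Gamma^e}$. $A(\Gamma)$ acts on $\Gamma^e$ on the right by conjugation, $x\mapsto x^g$. An element $g$ is loxodromic if $\tau(g)=\lim_{n\to\infty} d_{\Gamma^e}(x,x^{g^n})/n>0$ (independent of the vertex $x$). A bi-infinite geodesic is a subgraph that is a bi-infinite path isometrically embedded in $\Gamma^e$. The maximal degree of a graph is the maximum number of edges incident to a vertex. The girth is the minimum length of an embedded cycle (infinite if there are no cycles). *)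

(* Defs.v *)
From HB Require Import structures.
From mathcomp Require Import all_boot all_order all_algebra.
From mathcomp Require Import all_classical all_reals all_analysis.
Set Implicit Arguments.
Unset Strict Implicit.
Unset Printing Implicit Defensive.
Import Order.TTheory GRing.Theory Num.Theory.
Import numFieldNormedType.Exports.
Local Open Scope classical_set_scope.
Local Open Scope quotient_scope.

(** Graphs are adjacency relations [e : rel T], where [T] may be infinite. *)

Definition simplicial (T : eqType) (e : rel T) : Prop :=
  symmetric e /\ irreflexive e.

Definition connected_graph (V : finType) (e : rel V) : Prop :=
  (0 < #|V|)%N /\ forall x y : V, connect e x y.

Definition max_degree (V : finType) (e : rel V) : nat :=
  \max_(v : V) #|[set w | e v w]%SET|.

(** The cyclic sequence of the distinct vertices of an embedded cycle; a
    2-element [ucycle] runs back and forth along an edge. *)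
Definition embedded_cycle (T : eqType) (e : rel T) (c : seq T) : Prop :=
  (2 < size c)%N /\ ucycle e c.

(** The infimum of the empty set is [+oo], the girth of a forest. *)
Definition girth (R : realType) (T : eqType) (e : rel T) : \bar R :=
  ereal_inf [set ((size c)%:R%R)%:E | c in [set c | embedded_cycle e c]].

(** [p] lists the vertices of the walk after [x], so [size p] is its length. *)
Definition walk (T : eqType) (e : rel T) (x y : T) (p : seq T) : Prop :=
  path e x p /\ last x p = y.

(** Edge metric, [+oo] between distinct components. *)
Definition gdist (R : realType) (T : eqType) (e : rel T) (x y : T) : \bar R :=
  ereal_inf [set ((size p)%:R%R)%:E | p in [set p | walk e x y p]].

(** In a word, the letter [(v, true)] stands for [v], and [(v, false)] for
    its inverse. *)

Section RAAG.
Variables (V : finType) (e : rel V).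

Notation word := (seq (V * bool)).

Inductive raag_cong : word -> word -> Prop :=
| raag_refl w : raag_cong w w
| raag_sym w1 w2 : raag_cong w1 w2 -> raag_cong w2 w1
| raag_trans w1 w2 w3 :
    raag_cong w1 w2 -> raag_cong w2 w3 -> raag_cong w1 w3
| raag_cat w1 w1' w2 w2' :
    raag_cong w1 w1' -> raag_cong w2 w2' -> raag_cong (w1 ++ w2) (w1' ++ w2')
| raag_cancel v b : raag_cong [:: (v, b); (v, ~~ b)] [::]
| raag_comm u v :
    e u v -> raag_cong [:: (u, true); (v, true)] [:: (v, true); (u, true)].

Definition raag_congb (w1 w2 : word) : bool := `[< raag_cong w1 w2 >].

Lemma raag_congb_refl : reflexive raag_congb.
Proof. by move=> w; apply/asboolP; exact: raag_refl. Qed.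

Lemma raag_congb_sym : symmetric raag_congb.
Proof. by move=> w1 w2; apply/asboolP/asboolP; exact: raag_sym. Qed.

Lemma raag_congb_trans : transitive raag_congb.
Proof.
by move=> w2 w1 w3 /asboolP h12 /asboolP h23; apply/asboolP/(raag_trans h12).
Qed.

Canonical raag_equiv :=
  EquivRel raag_congb raag_congb_refl raag_congb_sym raag_congb_trans.

Definition raag : Type := {eq_quot raag_equiv}.
HB.instance Definition _ := Choice.on raag.
HB.instance Definition _ := EqQuotient.on raag.

Lemma raag_pi (w1 w2 : word) :
  raag_cong w1 w2 <-> \pi_raag w1 = \pi_raag w2.
Proof.
split=> [h|/eqmodP /asboolP//].
by apply/eqmodP/asboolP.
Qed.

Lemma raag_repr (w : word) : raag_cong (repr (\pi_raag w)) w.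
Proof. by apply/raag_pi; rewrite reprK. Qed.

Definition inv_word (w : word) : word := rev [seq (l.1, ~~ l.2) | l <- w].

Lemma inv_word_cat w1 w2 : inv_word (w1 ++ w2) = inv_word w2 ++ inv_word w1.
Proof. by rewrite /inv_word map_cat rev_cat. Qed.

Lemma inv_wordK : involutive inv_word.
Proof.
move=> w; rewrite /inv_word map_rev revK -map_comp -[RHS]map_id.
by apply: eq_map => -[v b] /=; rewrite negbK.
Qed.

Lemma inv_word_catl w : raag_cong (inv_word w ++ w) [::].
Proof.
elim: w => [|[v b] w ih]; first exact: raag_refl.
rewrite -cat1s inv_word_cat -catA; apply: raag_trans ih.
apply: raag_cat; first exact: raag_refl.
rewrite catA -[X in raag_cong _ X]cat0s; apply: raag_cat; last exact: raag_refl.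
by have := raag_cancel v (~~ b); rewrite negbK.
Qed.

Lemma inv_word_catr w : raag_cong (w ++ inv_word w) [::].
Proof. by rewrite -[X in X ++ _]inv_wordK; exact: inv_word_catl. Qed.

Definition raag_one : raag := \pi_raag [::].
Definition raag_mul (x y : raag) : raag := \pi_raag (repr x ++ repr y).
Definition raag_inv (x : raag) : raag := \pi_raag (inv_word (repr x)).

Lemma raag_mulA : associative raag_mul.
Proof.
move=> x y z; apply/raag_pi.
apply: (raag_trans (raag_cat (raag_refl _) (raag_repr _))).
by rewrite catA; apply/raag_cat/raag_refl/raag_sym/raag_repr.
Qed.

Lemma raag_mul1g : left_id raag_one raag_mul.
Proof.
move=> x; rewrite -[RHS]reprK; apply/raag_pi.
exact: (raag_cat (raag_repr [::]) (raag_refl _)).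
Qed.

Lemma raag_mulg1 : right_id raag_one raag_mul.
Proof.
move=> x; rewrite -[RHS]reprK; apply/raag_pi.
by have := raag_cat (raag_refl (repr x)) (raag_repr [::]); rewrite cats0.
Qed.

Lemma raag_mulVg : left_inverse raag_one raag_inv raag_mul.
Proof.
move=> x; apply/raag_pi; apply: raag_trans (inv_word_catl (repr x)).
exact/raag_cat/raag_refl/raag_repr.
Qed.

Lemma raag_mulgV : right_inverse raag_one raag_inv raag_mul.
Proof.
move=> x; apply/raag_pi; apply: raag_trans (inv_word_catr (repr x)).
exact/raag_cat/raag_repr/raag_refl.
Qed.

HB.instance Definition _ := isGroup.Build raag
  raag_mulA raag_mul1g raag_mulg1 raag_mulVg raag_mulgV.

Definition raag_gen (v : V) : raag := \pi_raag [:: (v, true)].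

End RAAG.

(** The extension graph is the relation [ext_adj] on [raag e], restricted to the
    vertex set [ext_vertex]: the other elements of the group are isolated points. Group
    conjugation is [x ^ g = g^-1 * (x * g)]. *)

Definition ext_vertex (V : finType) (e : rel V) : set (raag e) :=
  [set x | exists (v : V) (g : raag e), x = (raag_gen e v ^ g)%g].

Definition ext_adj (V : finType) (e : rel V) : rel (raag e) :=
  fun x y => `[< [/\ ext_vertex x, ext_vertex y, x <> y & commute x y] >].

Definition ext_dist (R : realType) (V : finType) (e : rel V)
    (x y : raag e) : \bar R :=
  gdist R (@ext_adj V e) x y.

(** The limit exists and is independent of the vertex [x] when the graph is
    connected. *)
Definition translation_length (R : realType) (V : finType) (e : rel V)
    (g x : raag e) : \bar R :=
  limn (fun n : nat => (ext_dist R x (x ^ (g ^+ n))%g * (n%:R^-1)%R%:E)%E).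

Definition loxodromic (R : realType) (V : finType) (e : rel V)
    (g : raag e) : Prop :=
  exists2 x, ext_vertex x & (0 < translation_length R g x)%E.

(** A subgraph that is an isometrically embedded line is an induced subgraph, so
    it is determined by its vertex set [L]. *)
Definition bi_infinite_geodesic (R : realType) (V : finType) (e : rel V)
    (L : set (raag e)) : Prop :=
  exists gamma : int -> raag e,
    [/\ forall i, ext_vertex (gamma i),
        forall i j, ext_dist R (gamma i) (gamma j) = (`|i - j|%:~R)%R%:E
      & L = range gamma].

(** [ordS i] is the cyclic successor of [i] in ['I_m]. *)
Definition cyclically_permutes (V : finType) (e : rel V) (g : raag e)
    (m : nat) (L : 'I_m -> set (raag e)) : Prop :=
  forall i : 'I_m, [set (x ^ g)%g | x in L i] = L (ordS i).

(* Main.v *)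
Require Import Defs.
From mathcomp Require Import all_boot all_order all_algebra.
From mathcomp Require Import all_classical all_reals all_analysis.
From mathcomp Require Import zify ring.
Set Implicit Arguments.
Unset Strict Implicit.
Unset Printing Implicit Defensive.
Import Order.TTheory GRing.Theory Num.Theory.
Import numFieldNormedType.Exports.

(** For a vertex [x] of the extension graph, count with sign how often a path in the
    Cayley graph from [1] to [g] crosses a hyperplane labelled by [x]. This number
    [cross x g] is a cocycle in [g], and it can only change along a path of the
    extension graph that meets the star of [x]. With the girth hypothesis it follows
    that the extension graph has no cycles of length less than 6.

    Let [g] be loxodromic. Some vertex [x] separates the past of [g] from its future.
    Let the slice [S] consist of the neighbours [a] of [x] such that no neighbour of
    [x] other than [a] separates [a] from the past. Elements of [S] are determined by
    their labels, so [S] has at most [N] elements. As short cycles are excluded, every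
    geodesic coming from the past can be changed so as to pass through [S], and also
    through all its translates, in order. Hence the translation length is the minimal
    mean weight of a closed walk in [S] with weights [d(s, s'^g)]; a closed walk of at
    most [N] steps attains it, and gives [m <= N] and [s] in [S] such that [g^m]
    translates [s] along a geodesic line. When [m] is minimal, the translates of this
    line by the powers of [g] are disjoint: a common point would give an axis for a
    smaller power of [g]. *)

(** * Axes in integer-valued metric spaces *)

Section IntegerMetric.
Variables (T : eqType) (X : T -> Prop) (d : T -> T -> nat).
Hypotheses (dxx : forall x, X x -> d x x = 0)
  (dC : forall x y, X x -> X y -> d x y = d y x)
  (dD : forall x y z, X x -> X y -> X z -> d x z <= d x y + d y z)
  (d0 : forall x y, X x -> X y -> d x y = 0 -> x = y)
  (d_geodesic : forall x y, X x -> X y -> exists p : nat -> T,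
    [/\ p 0 = x, p (d x y) = y, forall i, X (p i) & forall i, d (p i) (p i.+1) <= 1]).
Variables (a b : T -> T).
Hypotheses (aK : cancel a b) (bK : cancel b a)
  (Xa : forall x, X x -> X (a x)) (Xb : forall x, X x -> X (b x))
  (da : forall x y, X x -> X y -> d (a x) (a y) = d x y).

Lemma X_iter n x : X x -> X (iter n a x).
Proof. by elim: n => //= n IH /IH/Xa. Qed.

Lemma X_iterb n x : X x -> X (iter n b x).
Proof. by elim: n => //= n IH /IH/Xb. Qed.

Lemma d_iter n x y : X x -> X y -> d (iter n a x) (iter n a y) = d x y.
Proof. by move=> Xx Xy; elim: n => //= n <-; rewrite da //; apply: X_iter. Qed.

Lemma iterK n : cancel (iter n a) (iter n b).
Proof. by elim: n => // n IH x; rewrite iterSr /= aK IH. Qed.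

Lemma iterbK n : cancel (iter n b) (iter n a).
Proof. by elim: n => // n IH x; rewrite iterSr /= bK IH. Qed.

Lemma d_iterb n x y : X x -> X y -> d (iter n b x) (iter n b y) = d x y.
Proof.
by move=> Xx Xy; rewrite -(d_iter n) ?iterbK //; apply: X_iterb.
Qed.

Lemma d_iterM k n x : X x -> d x (iter (k * n) a x) <= n * d x (iter k a x).
Proof.
move=> Xx; elim: n => [|n IH]; first by rewrite muln0 dxx.
rewrite mulnS iterD; have Xk := X_iter k Xx; have Xkn := X_iter (k * n) Xx.
apply: leq_trans (dD Xx Xk (X_iter _ Xkn)) _; rewrite mulSn leq_add2l.
by rewrite d_iter.
Qed.

Lemma d_lip (p : nat -> T) : (forall i, X (p i)) -> (forall i, d (p i) (p i.+1) <= 1) ->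
  forall i j, i <= j -> d (p i) (p j) <= j - i.
Proof.
move=> Xp p1 i j ij; rewrite -(subnKC ij); elim: (j - i) => [|n IH].
  by rewrite addn0 dxx.
rewrite addnS; have := dD (Xp i) (Xp (i + n)) (Xp (i + n).+1).
by have := p1 (i + n); lia.
Qed.

(** [x] lies on an axis of the [m]-th power of [a]. *)
Definition on_axis m x : Prop :=
  [/\ X x, 0 < m, 0 < d x (iter m a x)
    & forall n, d x (iter (m * n) a x) = n * d x (iter m a x)].

Section Axis.
Variables (m : nat) (x0 : T).
Hypothesis (x0_axis : on_axis m x0).
Let t := d x0 (iter m a x0).
Let am := iter m a.

Let Xx0 : X x0. Proof. by case: x0_axis. Qed.
Let m_gt0 : 0 < m. Proof. by case: x0_axis. Qed.
Let t_gt0 : 0 < t. Proof. by case: x0_axis. Qed.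

Let p := sval (cid (d_geodesic Xx0 (X_iter m Xx0))).

Let p0 : p 0 = x0. Proof. by case: (svalP (cid (d_geodesic Xx0 (X_iter m Xx0)))). Qed.
Let pt : p t = am x0.
Proof. by case: (svalP (cid (d_geodesic Xx0 (X_iter m Xx0)))). Qed.
Let Xp i : X (p i).
Proof. by case: (svalP (cid (d_geodesic Xx0 (X_iter m Xx0)))). Qed.
Let p1 i : d (p i) (p i.+1) <= 1.
Proof. by case: (svalP (cid (d_geodesic Xx0 (X_iter m Xx0)))). Qed.

(** The translates of a geodesic [p] from [x0] to [iter m a x0] under the powers of [iter m a],
    joined end to end. *)
Definition ray i : T := iter (m * (i %/ t)) a (p (i %% t)).

Lemma X_ray i : X (ray i). Proof. exact: X_iter. Qed.

Lemma ray_add i n : ray (i + n * t) = iter (m * n) a (ray i).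
Proof. by rewrite /ray addnC divnMDl // modnMDl mulnDr iterD. Qed.

Lemma ray_mul n : ray (n * t) = iter (m * n) a x0.
Proof. by rewrite -[n * t]add0n ray_add /ray div0n mod0n muln0 p0. Qed.

Lemma ray_step i : d (ray i) (ray i.+1) <= 1.
Proof.
have [lt_it|le_ti] := ltnP (i %% t).+1 t.
  have E : i.+1 = (i %% t).+1 + i %/ t * t by rewrite addSn addnC -divn_eq.
  rewrite E ray_add [ray (i %% t).+1]/ray (divn_small lt_it) (modn_small lt_it) muln0.
  by rewrite {1}/ray d_iter //=.
have E : i.+1 = (i %/ t).+1 * t.
  by have := ltn_pmod i t_gt0; rewrite {1}(divn_eq i t) mulSn; lia.
rewrite E ray_mul mulnS addnC iterD -[iter m a x0]pt /ray d_iter //.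
have Et : (i %% t).+1 = t by apply/eqP; rewrite eqn_leq le_ti ltn_pmod.
by have := p1 (i %% t); rewrite Et.
Qed.

(** Steps have length at most 1, and by [on_axis] the ray covers the full distance [j * t] between
    the times 0 and [j * t]; so the triangle inequality leaves no slack in between. *)
Lemma d_ray i j : i <= j -> d (ray i) (ray j) = j - i.
Proof.
move=> ij; have L := d_lip X_ray ray_step.
apply/eqP; rewrite eqn_leq L //=.
have jt : j <= j * t by rewrite leq_pmulr.
have := dD (X_ray 0) (X_ray i) (X_ray (j * t)).
have := dD (X_ray i) (X_ray j) (X_ray (j * t)).
have := L _ _ (leq0n i); have := L _ _ jt.
have -> : d (ray 0) (ray (j * t)) = j * t.
  by rewrite -(mul0n t) !ray_mul muln0 /=; case: x0_axis.
by lia.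
Qed.

(** Going back by [`|i|] periods makes the argument of [ray] nonnegative. *)
Definition line (i : int) : T :=
  iter (m * `|i|) b (ray `|(i + (`|i| * t)%N%:Z)%R|).

(** Going back by any larger number of periods gives the same point, so that two points of the line
    can be compared on one ray. *)
Lemma lineE i n : `|i|%N <= n -> line i = iter (m * n) b (ray `|(i + (n * t)%N%:Z)%R|).
Proof.
move=> /subnKC <-; set k := n - _.
have it : `|i|%N <= `|i|%N * t by rewrite leq_pmulr.
have -> : `|(i + ((`|i| + k) * t)%N%:Z)%R|%N = `|(i + (`|i| * t)%N%:Z)%R|%N + k * t.
  by rewrite mulnDl; lia.
by rewrite ray_add mulnDr iterD iterK.
Qed.

Lemma X_line i : X (line i). Proof. exact/X_iterb/X_ray. Qed.

Lemma d_line i j : d (line i) (line j) = `|(i - j)%R|%N.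
Proof.
have [n [lin ljn]] : exists n, `|i|%N <= n /\ `|j|%N <= n.
  by exists (`|i| + `|j|)%N; rewrite leq_addr leq_addl.
rewrite (lineE lin) (lineE ljn) d_iterb; try exact: X_ray.
have nt : n <= n * t by rewrite leq_pmulr.
have [ij|ji] := leqP `|(i + (n * t)%N%:Z)%R|%N `|(j + (n * t)%N%:Z)%R|%N.
  by rewrite d_ray //; lia.
by rewrite dC ?d_ray; [lia|exact: ltnW|exact: X_ray..].
Qed.

Lemma line_add i n : line (i + (n * t)%N%:Z)%R = iter (m * n) a (line i).
Proof.
have [k [lik lnk]] : exists k, `|i|%N <= k /\ `|(i + (n * t)%N%:Z)%R|%N <= k.
  by exists (`|i| + `|(i + (n * t)%N%:Z)%R|)%N; rewrite leq_addr leq_addl.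
rewrite (lineE lik) (lineE lnk).
have kt : k <= k * t by rewrite leq_pmulr.
have -> : `|(i + (n * t)%N%:Z + (k * t)%N%:Z)%R|%N = `|(i + (k * t)%N%:Z)%R|%N + n * t.
  by lia.
rewrite ray_add; move: (ray _) => y.
have comm1 c z : iter c b (a z) = a (iter c b z).
  by elim: c z => //= c IH z; rewrite IH bK aK.
have comm c l z : iter c b (iter l a z) = iter l a (iter c b z).
  by elim: l => //= l IH; rewrite comm1 IH.
by rewrite comm.
Qed.

(** If [iter k a] maps a point [line i] of the axis to another one, then applying
    it repeatedly, together with powers of the translation [iter m a] of the axis,
    shows that it moves [line i] by exactly [k * t / m]. *)
Lemma line_meet k i j : 0 < k < m -> iter k a (line i) = line j -> on_axis k (line i).
Proof.
move=> /andP[k_gt0 km] Eij.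
have shift n : iter k a (line (i + (n * t)%N%:Z)%R) = line (j + (n * t)%N%:Z)%R.
  by rewrite !line_add -Eij -!iterD addnC.
have Xi := X_line i; have Xj := X_line j.
(* The [c] additional periods make the displacements positive. Iterating [m * c + k] bounds [j - i]
   from below, and iterating [m * c - k] from [line j] bounds it from above. *)
pose c := (`|i| + `|j| + k)%N.
have ct : c <= c * t by rewrite leq_pmulr.
have up : (k%:Z * t%:Z <= m%:Z * (j - i))%R.
  have := d_iterM (m * c + k) m Xi.
  rewrite iterD Eij -line_add.
  have -> : (m * c + k) * m = m * (m * c + k) by rewrite mulnC.
  rewrite -line_add !d_line; nia.
have lo : (m%:Z * (j - i) <= k%:Z * t%:Z)%R.
  have cm : k <= m * c by rewrite /c; nia.
  have E : iter (m * c - k) a (line j) = line (i + (c * t)%N%:Z)%R.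
    by rewrite -Eij -iterD subnK // line_add.
  have := d_iterM (m * c - k) m Xj; rewrite E.
  have -> : (m * c - k) * m = m * (m * c - k) by rewrite mulnC.
  rewrite -line_add !d_line; nia.
have mji : (m%:Z * (j - i) = k%:Z * t%:Z)%R by apply/eqP; rewrite eq_le up lo.
have ji : (0 < j - i)%R by nia.
split; rewrite ?Eij ?d_line //; first by lia.
move=> n; apply/eqP; rewrite eqn_leq.
have := d_iterM k n Xi; rewrite Eij d_line => -> /=.
(* The [m]-th power of [iter (k * n) a] moves [line i] by [k * n * t], which is [m * n * (j - i)];
   dividing by [m] gives the lower bound. *)
have := d_iterM (k * n) m Xi.
have -> : k * n * m = m * (k * n) by rewrite mulnC.
rewrite -line_add d_line => H.
have : (m * (n * `|(i - j)%R|) <= m * d (line i) (iter (k * n) a (line i)))%N.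
  apply: leq_trans H; nia.
by rewrite leq_pmul2l.
Qed.

End Axis.

Theorem disjoint_axes N : (exists m x, 0 < m <= N /\ on_axis m x) ->
  exists m (t : int) (l : int -> T), [/\ 0 < m <= N, forall i, X (l i),
    forall i j, d (l i) (l j) = `|(i - j)%R|%N,
    forall i, iter m a (l i) = l (i + t)%R
    & forall k i j, 0 < k < m -> iter k a (l i) <> l j].
Proof.
move=> [m0 [y0 [/andP[_ m0N] y0_axis]]].
pose Q m := `[< exists x, on_axis m x >].
have exQ : exists m, Q m by exists m0; apply/asboolP; exists y0.
have [m /asboolP[x0 x0_axis] mmin] := ex_minnP exQ.
have m_m0 : m <= m0 by apply: mmin; apply/asboolP; exists y0.
exists m, (d x0 (iter m a x0))%:Z%R, (line x0_axis); split.
- by case: x0_axis => _ -> _ _ /=; apply: leq_trans m0N.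
- exact: X_line.
- exact: d_line.
- by move=> i; have := line_add x0_axis i 1; rewrite mul1n muln1.
move=> k i j km /(line_meet km) axis; have : m <= k.
  by apply: mmin; apply/asboolP; exists (line x0_axis i).
by move/andP: km => [_]; rewrite ltnNge => /negP.
Qed.

(** * Closed walks of minimal mean weight *)

Section MeanCycle.
Variables (S : T -> Prop) (N n0 : nat) (y : T).
Hypotheses (SX : forall s, S s -> X s) (Sex : exists s, S s)
  (S_card : forall l : seq T, uniq l -> (forall s, s \in l -> S s) -> size l <= N)
  (a_free : forall x n, X x -> 0 < n -> iter n a x <> x)
  (Xy : X y)
  (S_slices : forall k s, n0 <= k -> S s -> exists2 s', S s' &
    d y (iter k.+1 a s) = d y (iter k a s') + d (iter k a s') (iter k.+1 a s)).

(** A list of points of [S] is read as a walk through successive translates of [S]; each step goes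
    from a point of one translate to a point of the next. *)
Fixpoint weight (l : seq T) : nat :=
  if l is x :: l' then (if l' is z :: _ then d x (a z) else 0) + weight l' else 0.

Lemma weight_cat p x q : weight (p ++ x :: q) = weight (rcons p x) + weight (x :: q).
Proof.
by elim: p => //= z [|z' p] IH; rewrite /= ?addn0 // in IH *; rewrite IH !addnA.
Qed.

(** Translating the [i]-th step by [iter i a] makes consecutive steps fit together, and the triangle
    inequality applies. *)
Lemma weight_ge x p : (forall s, s \in x :: p -> S s) ->
  d x (iter (size p) a (last x p)) <= weight (x :: p).
Proof.
elim: p x => [|z p IH] x Sp; first by rewrite /= dxx //; apply/SX/Sp/mem_head.
have Xx : X x by apply/SX/Sp/mem_head.
have Sp' s : s \in z :: p -> S s by move=> sp; apply: Sp; rewrite inE sp orbT.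
have Xz : X z by apply/SX/Sp'/mem_head.
have Xl : X (iter (size p) a (last z p)) by apply/X_iter/SX/Sp'/mem_last.
apply: leq_trans (dD Xx (Xa Xz) (X_iter (size p).+1 (SX (Sp' _ (mem_last _ _))))) _.
by rewrite /= da // leq_add2l; apply: IH.
Qed.

Lemma not_uniq_split (l : seq T) : ~~ uniq l ->
  exists p z q r, l = p ++ z :: q ++ z :: r.
Proof.
elim: l => //= x l IH; rewrite negb_and negbK => /orP[/splitPr[q r]|/IH].
  by exists [::], x, q, r.
by move=> [p [z [q [r ->]]]]; exists (x :: p), z, q, r.
Qed.

Lemma N_gt0 : 0 < N.
Proof.
have [s Ss] := Sex; have := @S_card [:: s] isT; apply.
by move=> s'; rewrite inE => /eqP ->.
Qed.

Lemma min_mean : exists m s, [/\ 0 < m <= N, S s & forall k s', 0 < k <= N -> S s' ->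
  d s (iter m a s) * k <= d s' (iter k a s') * m].
Proof.
pose Q v := `[< exists m s, [/\ 0 < m <= N, S s & v = d s (iter m a s) * (N`! %/ m)] >].
have exQ : exists v, Q v.
  have [s Ss] := Sex; exists (d s (iter 1 a s) * (N`! %/ 1)).
  by apply/asboolP; exists 1, s; rewrite N_gt0.
have [_ /asboolP[m [s [mN Ss ->]]] vmin] := ex_minnP exQ.
exists m, s; split => // k s' kN Ss'.
have /vmin : Q (d s' (iter k a s') * (N`! %/ k)) by apply/asboolP; exists k, s'.
have dv j : 0 < j <= N -> N`! %/ j * j = N`! by move=> jN; rewrite divnK // dvdn_fact.
rewrite -(leq_pmul2r (fact_gt0 N)) => le_v.
have := leq_mul le_v (leqnn (k * m)).
have -> : d s (iter m a s) * (N`! %/ m) * N`! * (k * m) =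
  d s (iter m a s) * k * (N`! * (N`! %/ m * m)) by ring.
have -> : d s' (iter k a s') * (N`! %/ k) * N`! * (k * m) =
  d s' (iter k a s') * m * (N`! * (N`! %/ k * k)) by ring.
by rewrite !dv // leq_pmul2r // muln_gt0 fact_gt0.
Qed.

(** A closed walk of length at most [N] has at least the minimal mean weight, and
    a walk with more than [N] vertices contains one. *)
Lemma weight_mean m s x p : 0 < m ->
  (forall k s', 0 < k <= N -> S s' -> d s (iter m a s) * k <= d s' (iter k a s') * m) ->
  (forall s, s \in x :: p -> S s) ->
  size p * d s (iter m a s) <= m * weight (x :: p) + N * d s (iter m a s).
Proof.
move=> m_gt0 mmin; have [n] := ubnP (size p); elim: n x p => // n IH x p pn Sp.
have [pN|Np] := leqP (size p) N.
  by apply: leq_trans (leq_addl _ _); rewrite leq_mul2r pN orbT.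
(* As [S] has at most [N] elements, one of the first [N.+1] vertices is repeated; the closed walk
   between two occurrences has at most [N] steps and is cut out. *)
have : ~~ uniq (take N.+1 (x :: p)).
  apply/negP => /S_card; rewrite size_take /= ltnS Np ltnn => H.
  by suff : false by []; apply: H => s' s't; apply: Sp; apply: (@mem_take N.+1).
move=> /not_uniq_split [p1 [z [q [r E]]]].
have szq : (size q).+1 <= N.
  have := congr1 size E; rewrite size_take /= ltnS Np size_cat /= size_cat /=; lia.
have [r' Ep] : exists r', p1 ++ z :: q ++ z :: r' = x :: p.
  exists (r ++ drop N.+1 (x :: p)).
  by rewrite -[RHS](cat_take_drop N.+1) E -catA /= -catA.
rewrite -Ep in Sp *.
have sz : size p = (size p1 + size q + size r').+1.
  by have := congr1 size Ep; rewrite !size_cat /= size_cat /=; lia.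
have Sz : S z by apply: Sp; rewrite mem_cat mem_head orbT.
rewrite weight_cat -[z :: q ++ z :: r']cat_cons weight_cat rcons_cons.
have wq : d s (iter m a s) * (size q).+1 <= m * weight (z :: rcons q z).
  apply: leq_trans (mmin _ _ _ Sz) _; rewrite ?ltnS //= mulnC leq_mul2l.
  have := @weight_ge z (rcons q z); rewrite last_rcons size_rcons => -> //; first by rewrite orbT.
  move=> s'; rewrite inE mem_rcons inE orbA orbb => /orP[/eqP->//|s'q].
  by apply: Sp; rewrite mem_cat inE mem_cat s'q !orbT.
have := IH (head z (rcons p1 z)) (behead (p1 ++ z :: r')).
have Eh : head z (rcons p1 z) :: behead (p1 ++ z :: r') = p1 ++ z :: r' by case: (p1).
have Sb : size (behead (p1 ++ z :: r')) = size p1 + size r'.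
  by rewrite size_behead size_cat /= addnS.
rewrite Eh Sb weight_cat sz => IH'.
have {}IH' : (size p1 + size r') * d s (iter m a s) <=
    m * (weight (rcons p1 z) + weight (z :: r')) + N * d s (iter m a s).
  apply: IH'; first by lia.
  move=> s' s'p; apply: Sp; move: s'p; rewrite !mem_cat !inE mem_cat inE.
  by case/or3P => ->; rewrite ?orbT.
by nia.
Qed.

(** The hypothesis [S_slices] is applied from the last slice backwards: the distances from [y]
    telescope into the weights, and the part before slice [n0] is dropped. *)
Lemma slice_walk n s : S s -> exists x p, [/\ size p = n, (forall s, s \in x :: p -> S s),
  last x p = s & weight (x :: p) <= d y (iter (n0 + n) a s)].
Proof.
elim: n s => [|n IH] s Ss.
  by exists s, [::]; split=> // s'; rewrite inE => /eqP->.
rewrite addnS; have [s' Ss' ->] := S_slices (leq_addr n n0) Ss.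
have [x [p [szp Sp lp wp]]] := IH s' Ss'.
exists x, (rcons p s); split; rewrite ?size_rcons ?last_rcons ?szp //.
  by move=> z; rewrite -rcons_cons mem_rcons inE => /orP[/eqP->|/Sp].
have -> : weight (x :: rcons p s) = weight (x :: p) + d s' (a s).
  case/lastP: p lp {szp Sp wp} => [/= ->|p z]; first by rewrite !addn0.
  rewrite last_rcons => ->; rewrite -!rcons_cons -[rcons (rcons _ _) s]cats1 cat_rcons.
  by rewrite weight_cat /= !addn0.
have E : d (iter (n0 + n) a s') (iter (n0 + n).+1 a s) = d s' (a s).
  by rewrite iterSr d_iter //; [exact: SX|exact/Xa/SX].
by rewrite E leq_add2r.
Qed.

Theorem short_axis : exists m s, [/\ 0 < m <= N & on_axis m s].
Proof.
have [m [s [mN Ss mmin]]] := min_mean; exists m, s; split=> //.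
have [m_gt0 _] := andP mN; have Xs := SX Ss.
set w := d s (iter m a s) in mmin.
have w_gt0 : 0 < w.
  rewrite lt0n; apply/eqP => /d0 E; apply: (a_free Xs m_gt0).
  exact/esym/E/X_iter.
split=> // k; apply/eqP; rewrite eqn_leq d_iterM //= leqNgt; apply/negP => lt_k.
pose c := d y s + d s (iter n0 a s).
(* A deficit of 1 over [m * k] iterations grows to [j] over [m * k * j] iterations. The walk through
   the slices has mean at least [w / m] up to an error independent of [j], which this [j]
   exceeds. *)
pose j := (m * c + N * w).+1.
have [x [p [szp Sp lp wp]]] := slice_walk (m * (k * j)) Ss.
have Xi l : X (iter l a s) by apply: X_iter.
have := weight_mean m_gt0 mmin Sp; rewrite -/w szp => wm.
have d1 := dD Xy Xs (Xi (n0 + m * (k * j))).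
have d2 := dD Xs (Xi n0) (Xi (n0 + m * (k * j))).
have d3 : d (iter n0 a s) (iter (n0 + m * (k * j)) a s) <= j * d s (iter (m * k) a s).
  by rewrite iterD d_iter // mulnA d_iterM.
have lt_k' : d s (iter (m * k) a s) + 1 <= k * w by rewrite addn1.
have d4 : j * (d s (iter (m * k) a s) + 1) <= j * (k * w) by rewrite leq_mul2l lt_k' orbT.
have H : weight (x :: p) + j <= c + j * (k * w) by rewrite /c; lia.
have H2 : m * (weight (x :: p) + j) <= m * (c + j * (k * w)) by rewrite leq_mul2l H orbT.
have H3 : m * j <= m * c + N * w.
  have E : m * (k * j) * w = m * (j * (k * w)) by ring.
  rewrite E in wm; rewrite (mulnDr m (weight _) j) (mulnDr m c) in H2.
  rewrite -(leq_add2l (m * weight (x :: p))); apply: leq_trans H2 _.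
  by rewrite addnCA leq_add2l.
have H4 : j <= m * j by rewrite leq_pmull.
by move: (leq_trans H4 H3); rewrite /j ltnn.
Qed.

End MeanCycle.
End IntegerMetric.

(** * The edge metric with natural values *)

Section GraphDistance.
Variables (T : eqType) (r : rel T) (X : T -> Prop).
Hypotheses (r_sym : symmetric r) (rX : forall x y, r x y -> X y)
  (r_conn : forall x y, X x -> X y -> exists p, walk r x y p).

Lemma walk_cat x y z p q : walk r x y p -> walk r y z q -> walk r x z (p ++ q).
Proof. by move=> [xp <-] [yq <-]; split; rewrite ?cat_path ?xp // last_cat. Qed.

Lemma walk_rev x y p : walk r x y p -> exists2 q, walk r y x q & size q = size p.
Proof.
move=> [xp <-]; exists (rev (belast x p)); last by rewrite size_rev size_belast.
split; first by rewrite rev_path; under eq_path => u v do rewrite r_sym.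
by case: p xp => //= z p _; rewrite rev_cons last_rcons.
Qed.

Definition walk_length x y n : bool := `[< exists2 p, walk r x y p & size p = n >].

(** The value 0 for points not joined by a walk is arbitrary; on [X] a walk exists by [r_conn]. *)
Definition graph_dist x y : nat :=
  if pselect (exists n, walk_length x y n) is left H then ex_minn H else 0.

Lemma graph_dist_le x y p : walk r x y p -> graph_dist x y <= size p.
Proof.
move=> xyp; rewrite /graph_dist; case: pselect => // H.
by case: ex_minnP => n _ nmin; apply: nmin; apply/asboolP; exists p.
Qed.

Lemma graph_distP x y : X x -> X y -> exists2 p, walk r x y p & size p = graph_dist x y.
Proof.
move=> Xx Xy; rewrite /graph_dist; case: pselect => [H|].
  by case: ex_minnP => n /asboolP.
have [p xyp] := r_conn Xx Xy.
by case; exists (size p); apply/asboolP; exists p.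
Qed.

Lemma gdist_graph_dist (R : realType) x y : X x -> X y ->
  gdist R r x y = ((graph_dist x y)%:R%R)%:E.
Proof.
move=> Xx Xy; apply/eqP; rewrite eq_le; apply/andP; split.
  have [p xyp <-] := graph_distP Xx Xy.
  by apply: ereal_inf_lbound; exists p.
apply: le_ereal_inf_tmp => _ [p xyp <-].
by rewrite lee_fin ler_nat graph_dist_le.
Qed.

Lemma graph_distxx x : graph_dist x x = 0.
Proof.
by apply/eqP; rewrite -leqn0; apply: (@graph_dist_le x x [::]).
Qed.

Lemma graph_dist_eq0 x y : X x -> X y -> graph_dist x y = 0 -> x = y.
Proof.
move=> Xx Xy; have [p [_ <-] <-] := graph_distP Xx Xy.
by move=> /eqP; rewrite size_eq0 => /eqP->.
Qed.

Lemma graph_distC x y : X x -> X y -> graph_dist x y = graph_dist y x.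
Proof.
move=> Xx Xy; apply/eqP; rewrite eqn_leq; apply/andP; split.
  by have [p /walk_rev [q yxq <-] <-] := graph_distP Xy Xx; apply: graph_dist_le.
by have [p /walk_rev [q yxq <-] <-] := graph_distP Xx Xy; apply: graph_dist_le.
Qed.

Lemma graph_distD x y z : X x -> X y -> X z ->
  graph_dist x z <= graph_dist x y + graph_dist y z.
Proof.
move=> Xx Xy Xz; have [p xyp <-] := graph_distP Xx Xy.
have [q yzq <-] := graph_distP Xy Xz.
by rewrite -size_cat; apply/graph_dist_le/walk_cat/yzq.
Qed.

Lemma graph_dist_adj x y : r x y -> graph_dist x y <= 1.
Proof. by move=> xy; apply: (@graph_dist_le x y [:: y]); rewrite /walk /= xy. Qed.

Lemma path_X x p y : X x -> path r x p -> y \in x :: p -> X y.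
Proof.
elim: p x => [|z p IH] x Xx /=; first by rewrite inE => _ /eqP->.
by move=> /andP[/rX Xz zp]; rewrite inE => /orP[/eqP->//|]; apply: IH.
Qed.

Lemma walk_split x y p z : X x -> walk r x y p -> size p = graph_dist x y -> z \in x :: p ->
  graph_dist x y = graph_dist x z + graph_dist z y.
Proof.
move=> Xx xyp szp zp; have Xz := path_X Xx xyp.1 zp.
have Xy : X y by have [xp <-] := xyp; apply: path_X (mem_last _ _).
apply/eqP; rewrite eqn_leq graph_distD //=.
suff [p1 [p2 [Ep xz zy]]] : exists p1 p2, [/\ p = p1 ++ p2, walk r x z p1 & walk r z y p2].
  by rewrite -szp Ep size_cat leq_add // graph_dist_le.
case/splitPl: p / zp xyp {szp} => p1 p2 lz [].
rewrite cat_path last_cat lz => /andP[xp1 zp2] l2.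
by exists p1, p2.
Qed.

Lemma graph_geodesic x y : X x -> X y -> exists p : nat -> T,
  [/\ p 0 = x, p (graph_dist x y) = y, forall i, X (p i)
    & forall i, graph_dist (p i) (p i.+1) <= 1].
Proof.
move=> Xx Xy; have [p [xp ly] szp] := graph_distP Xx Xy.
(* The default value [y] makes the path stay at its end. *)
exists (fun i => nth y (x :: p) i); split=> // [|i|i].
- by rewrite -szp -ly; case: (p) => //= z q; rewrite (set_nth_default z) ?nth_last //.
- have [ip|pi] := ltnP i (size (x :: p)); last by rewrite nth_default.
  exact/(path_X Xx xp)/mem_nth.
- have [ip|pi] := ltnP i (size p).
    by apply: graph_dist_adj; move/(pathP y): xp => /(_ _ ip).
  rewrite [nth y (x :: p) i.+1]nth_default //.
  suff -> : nth y (x :: p) i = y by rewrite graph_distxx.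
  move: pi; rewrite leq_eqVlt => /orP[/eqP<-|pi]; last by rewrite nth_default.
  by rewrite -[size p]/((size (x :: p)).-1) nth_last /= ly.
Qed.

Lemma graph_dist_pred x y : X x -> X y -> x <> y ->
  exists2 z, r z y & graph_dist x y = (graph_dist x z).+1.
Proof.
move=> Xx Xy nxy; have [p xyp szp] := graph_distP Xx Xy.
case/lastP: p xyp szp => [[_ //]|p z] [xp]; rewrite last_rcons => Ez; subst z.
rewrite size_rcons => szp; move: xp; rewrite rcons_path => /andP[xp ly].
exists (last x p) => //; apply/eqP; rewrite eqn_leq -{2}szp ltnS.
rewrite (@graph_dist_le _ _ p) // andbT.
have Xl : X (last x p) by apply: path_X (mem_last _ _).
by apply: leq_trans (graph_distD Xx Xl Xy) _; rewrite -addn1 leq_add2l graph_dist_adj.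
Qed.

Lemma graph_dist_eq1 x y : X x -> X y -> graph_dist x y = 1 -> r x y.
Proof.
move=> Xx Xy xy1; have nxy : x <> y by move=> E; move: xy1; rewrite E graph_distxx.
have [z zy] := graph_dist_pred Xx Xy nxy; rewrite xy1 => -[/esym xz].
by rewrite (graph_dist_eq0 Xx _ xz) //; apply: (@rX y); rewrite r_sym.
Qed.

End GraphDistance.

Local Open Scope classical_set_scope.

(** * Graphs of girth at least six *)

Section Girth.
Variables (R : realType) (T : eqType) (e : rel T).
Hypotheses (e_sym : symmetric e) (e_irr : irreflexive e).
Hypothesis e_girth : ((6%:R)%R%:E <= girth R e)%E.

Lemma girth_size c : 2 < size c -> cycle e c -> uniq c -> 5 < size c.
Proof.
move=> c2 cc uc; rewrite -(ler_nat R) -lee_fin; apply: le_trans e_girth _.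
by apply: ereal_inf_lbound; exists c => //; split=> //; rewrite /ucycle cc.
Qed.

Lemma edge_neq a b : e a b -> (a == b) = false.
Proof. by move=> ab; apply/eqP => E; rewrite E e_irr in ab. Qed.

Lemma girth_triangle a b c : e a b -> e b c -> e c a -> False.
Proof.
move=> ab bc ca; have := @girth_size [:: a; b; c] isT.
rewrite /= ab bc ca !inE (edge_neq ab) (edge_neq bc) eq_sym (edge_neq ca).
by move=> /(_ isT isT).
Qed.

Lemma girth_square a b c d : e a b -> e b c -> e c d -> e d a -> a <> c -> b = d.
Proof.
move=> ab bc cd da /eqP/negPf nac; apply/eqP/negPn/negP => /negPf nbd.
have := @girth_size [:: a; b; c; d] isT.
rewrite /= ab bc cd da !inE (edge_neq ab) (edge_neq bc) (edge_neq cd) nac nbd.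
by rewrite eq_sym (edge_neq da) => /(_ isT isT).
Qed.

(** If two of the five vertices coincided, a triangle would remain; so the cycle is embedded and too
    short. *)
Lemma girth_pentagon a b c d f : e a b -> e b c -> e c d -> e d f -> e f a -> False.
Proof.
move=> ab bc cd df fa; have := @girth_size [:: a; b; c; d; f] isT.
have nac : (a == c) = false.
  by apply/eqP => E; apply: (girth_triangle _ df fa); rewrite E.
have nad : (a == d) = false.
  by apply/eqP => E; apply: (girth_triangle ab bc); rewrite E.
have nbd : (b == d) = false.
  by apply/eqP => E; apply: (girth_triangle _ fa ab); rewrite E.
have nbf : (b == f) = false.
  by apply/eqP => E; apply: (girth_triangle bc cd); rewrite E.
have ncf : (c == f) = false.
  by apply/eqP => E; apply: (girth_triangle ab bc); rewrite E.
rewrite /= ab bc cd df fa !inE nac nad nbd nbf ncf.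
rewrite (edge_neq ab) (edge_neq bc) (edge_neq cd) (edge_neq df) eq_sym (edge_neq fa).
by move=> /(_ isT isT).
Qed.

End Girth.

(** * Subadditive sequences *)

Section SubadditiveMean.
Variable (R : realType) (D : nat -> nat).
Hypothesis D_sub : forall m n, D (m + n) <= D m + D n.

Lemma subadditive_mul m n : D (n.+1 * m) <= n.+1 * D m.
Proof.
elim: n => [|n IH]; first by rewrite !mul1n.
by rewrite mulSn; apply: leq_trans (D_sub _ _) _; rewrite (mulSn n.+1) leq_add2l.
Qed.

(** Division of [n] by [m] costs [D m] for each full block, and the remainder contributes at most
    the sum of the first [m] values. *)
Lemma subadditive_linear K m : 0 < m -> K * D m < m ->
  exists B, forall n, K * D n <= n + B.
Proof.
move=> m0 Km; exists (K * \sum_(i < m) D i) => n.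
have Dr : D (n %% m) <= \sum_(i < m) D i.
  by rewrite (bigD1 (Ordinal (ltn_pmod n m0))) //= leq_addr.
rewrite [in D n](divn_eq n m).
case E : (n %/ m) => [|q].
  by rewrite mul0n add0n; apply: leq_trans (leq_addl _ _); rewrite leq_mul2l Dr orbT.
apply: (@leq_trans (K * (q.+1 * D m + D (n %% m)))).
  rewrite leq_mul2l; apply/orP; right; apply: leq_trans (D_sub _ _) _.
  by rewrite leq_add2r subadditive_mul.
rewrite mulnDr leq_add ?leq_mul2l ?Dr ?orbT //.
apply: leq_trans (leq_divM n m); rewrite E mulnCA leq_mul2l; lia.
Qed.

(** A single value [D m] below [m / K] controls all large [n] by subadditivity. The contrapositive
    turns positive translation length into linear growth. *)
Lemma subadditive_mean_cvg0 : (forall K, exists n, K * D n < n) ->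
  ((fun n => (D n)%:R / n%:R : R) @ \oo --> (0 : R))%R.
Proof.
move=> H; apply/cvgr0Pnorm_le => eps eps0.
(* The factor 2 absorbs the constant [B]: once [B <= n], the bound [n + B] is at most [2 * n]. *)
have [K HK] : exists K, (2 / eps < K%:R)%R.
  exists (Num.bound (2 / eps)%R); apply: Num.Theory.archi_boundP.
  by apply: divr_ge0 => //; exact: ltW.
have [m Km] := H K; have m0 : 0 < m by case: m Km.
have [B HB] := subadditive_linear m0 Km.
near=> n.
have n0 : 0 < n by near: n; exact: nbhs_infty_gt.
have nB : B <= n by near: n; exact: nbhs_infty_ge.
have KD : (K * D n <= 2 * n)%N by apply: leq_trans (HB n) _; lia.
rewrite ger0_norm; last by apply: divr_ge0; exact: ler0n.
rewrite ler_pdivrMr ?ltr0n //.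
have K0 : (0 < K%:R :> R)%R by apply: lt_trans HK; apply: divr_gt0.
rewrite -(ler_pM2l K0) -natrM; apply: (@le_trans _ _ (2 * n)%:R%R).
  by rewrite ler_nat.
rewrite natrM mulrA ler_pM2r ?ltr0n // -ler_pdivrMr //; exact: ltW.
Unshelve. all: by end_near.
Qed.

End SubadditiveMean.

Local Open Scope quotient_scope.
Local Open Scope group_scope.

(** * Normal forms and centralizers *)

Section WordsAndPilings.
Variables (V : finType) (e : rel V).
Hypotheses (e_sym : symmetric e) (e_irr : irreflexive e).

Local Notation G := (raag e).
Local Notation word := (seq (V * bool)).
Local Notation gen := (raag_gen e).

Definition evalw (w : word) : G := \pi_(raag e) w.

Lemma evalw_repr (g : G) : evalw (repr g) = g.
Proof. exact: reprK. Qed.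

Lemma evalw_cat (w1 w2 : word) : evalw (w1 ++ w2) = evalw w1 * evalw w2.
Proof.
apply/raag_pi; apply: raag_cat; apply: raag_sym; exact: raag_repr.
Qed.

Lemma evalw_nil : evalw [::] = 1.
Proof. by []. Qed.

Lemma evalwP (g : G) : exists w, g = evalw w.
Proof. by exists (repr g); rewrite evalw_repr. Qed.

Definition letter (l : V * bool) : G := evalw [:: l].

Lemma evalw_cons l w : evalw (l :: w) = letter l * evalw w.
Proof. by rewrite -cat1s evalw_cat. Qed.

Lemma evalw_rcons w l : evalw (rcons w l) = evalw w * letter l.
Proof. by rewrite -cats1 evalw_cat. Qed.

Lemma letter_true v : letter (v, true) = gen v.
Proof. by []. Qed.

Lemma letterN v b : letter (v, ~~ b) = (letter (v, b))^-1.
Proof.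
apply/esym/mulg1_eq; rewrite -evalw_cat; apply/raag_pi; exact: raag_cancel.
Qed.

Lemma letter_false v : letter (v, false) = (gen v)^-1.
Proof. by rewrite -letter_true -letterN. Qed.

Lemma gen_commute u v : e u v -> commute (gen u) (gen v).
Proof.
by move=> uv; rewrite /commute -!letter_true -!evalw_cat; apply/raag_pi/raag_comm.
Qed.

Lemma commute_letter (x : G) v b : commute x (gen v) -> commute x (letter (v, b)).
Proof. by move=> xv; case: b; [|rewrite letter_false; apply: commuteV]. Qed.

Lemma letter_commute u v b c : e u v -> commute (letter (u, b)) (letter (v, c)).
Proof.
move=> uv; apply: commute_letter; apply: commute_sym; apply: commute_letter.
by apply: commute_sym; apply: gen_commute.
Qed.

Lemma letter_commute_gen u b : commute (letter (u, b)) (gen u).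
Proof. by apply: commute_sym; apply: commute_letter; exact: commute_refl. Qed.

(** A state assigns to each vertex a stack; appending the letter [(v, b)] to a
    reduced word puts [Some b] on the stack of [v] and a blocking [None] on the
    stack of every vertex that does not commute with [v]. *)
Definition state : Type := V -> seq (option bool).

Definition state0 : state := fun=> [::].

Definition top (s : state) v : option bool := head None (s v).

Definition push (l : V * bool) (s : state) : state := fun u =>
  if u == l.1 then Some l.2 :: s u else if e u l.1 then s u else None :: s u.

Definition pop v (s : state) : state := fun u =>
  if (u == v) || ~~ e u v then behead (s u) else s u.

Definition act (s : state) (l : V * bool) : state :=
  if top s l.1 == Some (~~ l.2) then pop l.1 s else push l s.

Inductive reduced : word -> state -> Prop :=
| reduced_nil : reduced [::] state0
| reduced_rcons w s l : reduced w s -> top s l.1 <> Some (~~ l.2) ->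
    reduced (rcons w l) (push l s).

Lemma reduced_inv w s : reduced w s ->
  (w = [::] /\ s = state0) \/
  exists w' s' l, [/\ w = rcons w' l, s = push l s' & reduced w' s'].
Proof. by case=> [|w' s' l rw _]; [left|right; exists w', s', l]. Qed.

Lemma push_pop l s : pop l.1 (push l s) = s.
Proof.
apply/funext => u; rewrite /pop /push; case: eqVneq => //= _.
by case: (e u l.1).
Qed.

Lemma pushC u v b c s : e u v -> u <> v ->
  push (u, b) (push (v, c) s) = push (v, c) (push (u, b) s).
Proof.
move=> uv nuv; apply/funext => t; rewrite /push /=.
case: (eqVneq t u) => [->|tu]; case: (eqVneq _ v) => [E|tv] //.
- by rewrite uv.
- by rewrite E e_sym uv.
- by do 2!case: ifP.
Qed.

Lemma top_push l s : top (push l s) l.1 = Some l.2.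
Proof. by rewrite /top /push eqxx. Qed.

Lemma stack_push_comm l s u : e u l.1 -> push l s u = s u.
Proof. by rewrite /push; case: eqVneq => [->|_ ->//]; rewrite e_irr. Qed.

Lemma top_push_comm l s u : e u l.1 -> top (push l s) u = top s u.
Proof. by move=> ul; rewrite /top stack_push_comm. Qed.

Lemma top_push_block l s u : u <> l.1 -> ~~ e u l.1 -> top (push l s) u = None.
Proof. by move=> /eqP/negPf ul /negPf el; rewrite /top /push ul el. Qed.

(** The letter on top of the stack of [v] can be shuffled to the end of the word: the later letters
    have put no block on this stack, so they commute with [v]. *)
Lemma reduced_top w s v b : reduced w s -> top s v = Some b ->
  exists w' s', [/\ reduced w' s', top s' v <> Some (~~ b), s = push (v, b) s',
    evalw w = evalw w' * letter (v, b) & size w = (size w').+1].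
Proof.
move=> rw; elim: rw v b => [//|{}w {}s [u c] rw IH us v b tv].
have [vu|nvu] := eqVneq v u.
  rewrite vu top_push in tv; case: tv => cb; subst v c.
  by exists w, s; split => //; rewrite ?size_rcons ?evalw_rcons.
have [evu|nevu] := boolP (e v u); last first.
  by rewrite top_push_block //= in tv; apply/eqP.
have euv : e u v by rewrite e_sym.
have nuv : u <> v by move=> uv; rewrite uv eqxx in nvu.
rewrite top_push_comm // in tv.
have [w' [s' [rw' ts' Es Ew sz]]] := IH _ _ tv.
exists (rcons w' (u, c)), (push (u, c) s'); split.
- apply: reduced_rcons => //=; move: us; rewrite Es /=.
  by rewrite top_push_comm.
- by rewrite top_push_comm.
- by rewrite Es pushC.
- by rewrite !evalw_rcons Ew -!mulgA; congr (_ * _); apply: letter_commute; rewrite e_sym.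
- by rewrite !size_rcons sz.
Qed.

(** The last letter of one word is on top of its stack, hence can be shuffled to the end of the
    other word and removed from both. *)
Lemma reduced_uniq w1 w2 s : reduced w1 s -> reduced w2 s ->
  size w1 = size w2 /\ evalw w1 = evalw w2.
Proof.
move=> r1; elim: r1 w2 => [|{}w1 {}s l r1 IH ls] w2 r2.
  have [[-> _] //|[w2' [s' [l' [_ E _]]]]] := reduced_inv r2.
  by move: (congr1 (top ^~ l'.1) E); rewrite top_push.
case: l ls r2 => v b ls r2.
have [w2' [s' [r2' _ Es -> ->]]] := reduced_top r2 (top_push _ _).
have Es' : s = s'.
  by rewrite -(push_pop (v, b) s) /= Es -[v]/((v, b).1) push_pop.
rewrite -Es' in r2'; have [sz E] := IH _ r2'.
by rewrite size_rcons evalw_rcons sz E.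
Qed.

Lemma act_reduced w s l : reduced w s ->
  exists2 w', reduced w' (act s l) & evalw w' = evalw w * letter l.
Proof.
case: l => v b rw; rewrite /act /=; case: eqP => [tv|tv].
  have [w' [s' [rw' _ -> -> _]]] := reduced_top rw tv.
  exists w'; first by rewrite -[v]/((v, ~~ b).1) push_pop.
  by rewrite letterN mulgVK.
by exists (rcons w (v, b)); [apply: reduced_rcons|rewrite evalw_rcons].
Qed.

(** On arbitrary stacks [pop] may remove entries that the matching [push] does not put back, so the
    group acts on legal states only. *)
Definition legal (s : state) : Prop := exists w, reduced w s.

Lemma legal_act s l : legal s -> legal (act s l).
Proof. by move=> [w rw]; have [w' rw' _] := act_reduced l rw; exists w'. Qed.

Lemma legal_foldl s w : legal s -> legal (foldl act s w).
Proof. by elim: w s => //= l w IH s ls; apply/IH/legal_act. Qed.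

Lemma legal_top s v b : legal s -> top s v = Some b ->
  exists s', [/\ legal s', top s' v <> Some (~~ b) & s = push (v, b) s'].
Proof.
move=> [w rw] tv; have [w' [s' [rw' ts' -> _ _]]] := reduced_top rw tv.
by exists s'; split=> //; exists w'.
Qed.

Lemma act_push (s : state) v b :
  top s v <> Some (~~ b) -> act s (v, b) = push (v, b) s.
Proof. by move=> /eqP/negPf; rewrite /act /= => ->. Qed.

Lemma act_pushN (s : state) v b : act (push (v, ~~ b) s) (v, b) = s.
Proof.
rewrite /act /= -[X in top _ X]/((v, ~~ b).1) top_push eqxx.
by rewrite -[v]/((v, ~~ b).1) push_pop.
Qed.

Lemma actK s v b : legal s -> act (act s (v, b)) (v, ~~ b) = s.
Proof.
move=> ls; have [tv|tv] := eqVneq (top s v) (Some (~~ b)).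
  have [s' [_ ts' ->]] := legal_top ls tv.
  by rewrite act_pushN act_push.
rewrite (@act_push s); last by apply/eqP.
by rewrite -{1}[b]negbK act_pushN.
Qed.

Lemma actC s u v b c : legal s -> e u v ->
  act (act s (u, b)) (v, c) = act (act s (v, c)) (u, b).
Proof.
move=> ls uv; have nuv : u <> v by move=> E; rewrite E e_irr in uv.
have nvu : v <> u by move=> E; apply: nuv.
have vu : e v u by rewrite e_sym.
(* By symmetry, it may be assumed that a cancellation at [v] comes with one at [u]. *)
wlog : u v b c uv nuv nvu vu / top s v = Some (~~ c) -> top s u = Some (~~ b).
  move=> W; have [tu|/eqP tu] := eqVneq (top s u) (Some (~~ b)).
    exact: W.
  by apply/esym/W.
have [tv|tv] := eqVneq (top s v) (Some (~~ c)) => H.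
  have tu := H tv; have [s' [ls' ts' Es]] := legal_top ls tu.
  move: tv; rewrite Es top_push_comm // => /(legal_top ls') [s2 [_ ts2 Es2]].
  by rewrite act_pushN Es2 act_pushN (pushC _ _ _ uv nuv) act_pushN act_pushN.
have [tu|tu] := eqVneq (top s u) (Some (~~ b)).
  have [s' [ls' ts' Es]] := legal_top ls tu; rewrite Es act_pushN.
  have ts'v : top s' v <> Some (~~ c).
    by move: tv => /eqP; rewrite Es top_push_comm.
  rewrite !(@act_push _ v c) ?top_push_comm //.
  by rewrite -(pushC _ _ _ uv nuv) act_pushN.
have {}tu : top s u <> Some (~~ b) by apply/eqP.
have {}tv : top s v <> Some (~~ c) by apply/eqP.
by rewrite !act_push ?act_push ?top_push_comm // pushC.
Qed.

(** The defining relations act trivially on legal states. Hence the state reached from [state0] is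
    an invariant of the group element, which makes reduced words normal forms. *)
Lemma foldl_act_cong w1 w2 : raag_cong e w1 w2 ->
  forall s, legal s -> foldl act s w1 = foldl act s w2.
Proof.
elim=> {w1 w2} [//|w1 w2 _ IH s ls|w1 w2 w3 _ IH1 _ IH2 s ls
  |w1 w1' w2 w2' _ IH1 _ IH2 s ls|v b s ls|u v uv s ls].
- by rewrite IH.
- by rewrite IH1 ?IH2.
- by rewrite !foldl_cat IH1 // IH2 //; apply: legal_foldl.
- by rewrite /= actK.
- by rewrite /= actC.
Qed.

Lemma legal0 : legal state0.
Proof. by exists [::]; apply: reduced_nil. Qed.

Definition stack (g : G) : state := foldl act state0 (repr g).

Lemma stack_evalw w : stack (evalw w) = foldl act state0 w.
Proof. by apply: foldl_act_cong legal0; apply: raag_repr. Qed.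

Lemma stack_letter g l : stack (g * letter l) = act (stack g) l.
Proof.
by have [w ->] := evalwP g; rewrite -evalw_rcons !stack_evalw foldl_rcons.
Qed.

Lemma normal_form g : exists2 w, reduced w (stack g) & g = evalw w.
Proof.
have [w ->] := evalwP g; elim/last_ind: w => [|w l [w' rw' E]].
  by exists [::] => //; rewrite stack_evalw; apply: reduced_nil.
rewrite evalw_rcons stack_letter E.
have [w2 r2 E2] := act_reduced l rw'; exists w2.
  by rewrite -E.
by rewrite E2.
Qed.

Definition nform g : word := s2val (cid2 (normal_form g)).

Lemma nform_reduced g : reduced (nform g) (stack g).
Proof. exact: (s2valP (cid2 (normal_form g))). Qed.

Lemma evalw_nform g : evalw (nform g) = g.
Proof. exact/esym/(s2valP' (cid2 (normal_form g))). Qed.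

Definition len g : nat := size (nform g).

Lemma len_reduced g w : reduced w (stack g) -> len g = size w.
Proof. by move=> rw; have [] := reduced_uniq (nform_reduced g) rw. Qed.

Lemma stack_legal g : legal (stack g).
Proof. by exists (nform g); apply: nform_reduced. Qed.

Lemma len_push g v b : top (stack g) v <> Some (~~ b) ->
  len (g * letter (v, b)) = (len g).+1.
Proof.
move=> tv; rewrite (@len_reduced _ (rcons (nform g) (v, b))) ?size_rcons //.
by rewrite stack_letter act_push //; apply: reduced_rcons => //; apply: nform_reduced.
Qed.

Lemma top_factor g v b : top (stack g) v = Some b -> exists g',
  [/\ g = g' * letter (v, b), len g = (len g').+1
    & top (stack g') v <> Some (~~ b)].
Proof.
move=> tv; exists (g * letter (v, ~~ b)); set g' := g * letter (v, ~~ b).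
have E : g = g' * letter (v, b) by rewrite /g' letterN mulgVK.
have ts' : top (stack g') v <> Some (~~ b).
  have [s' [_ ts' Es]] := legal_top (stack_legal g) tv.
  by rewrite stack_letter Es -{1}[b]negbK act_pushN.
by split; rewrite // -(len_push ts') -E.
Qed.

Lemma top_neq1 g : g <> 1 -> exists v b, top (stack g) v = Some b.
Proof.
move=> g1; have [[Ew _]|[w [s [[v b] [_ -> _]]]]] := reduced_inv (nform_reduced g).
  by case: g1; rewrite -(evalw_nform g) Ew.
by exists v, b; apply: (top_push (v, b)).
Qed.

Lemma len_evalw w : (len (evalw w) <= size w)%N.
Proof.
elim/last_ind: w => [|w [v b] IH].
  by rewrite (@len_reduced _ [::]) // stack_evalw; apply: reduced_nil.
rewrite evalw_rcons size_rcons.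
have [tv|/eqP tv] := eqVneq (top (stack (evalw w)) v) (Some (~~ b)).
  have [g' [Eg sz _]] := top_factor tv.
  by rewrite Eg letterN mulgVK leqW // ltnW // -sz.
by rewrite len_push // ltnS.
Qed.

Lemma len_letterl g l : (len (letter l * g)%g <= (len g).+1)%N.
Proof. by rewrite -{1}(evalw_nform g) -evalw_cons; apply: len_evalw. Qed.

End WordsAndPilings.

(** * Retractions, centralizers and vertices of the extension graph *)

Section Retractions.
Variables (V : finType) (e : rel V).
Hypotheses (e_sym : symmetric e) (e_irr : irreflexive e).

Local Notation G := (raag e).
Local Notation word := (seq (V * bool)).
Local Notation gen := (raag_gen e).
Local Notation evalw := (@evalw V e).
Local Notation letter := (@letter V e).

Lemma commuteJ (x y h : G) : commute (x ^ h) (y ^ h) <-> commute x y.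
Proof.
by split=> [|E]; rewrite /commute -!conjMg ?E // => /conjg_inj.
Qed.

Lemma conjg_commute (x h : G) : commute x h -> x ^ h = x.
Proof. by move=> xh; rewrite /conjg xh mulKg. Qed.

Definition gen_by (S : pred V) (g : G) : Prop :=
  exists2 w, all (fun l : V * bool => S l.1) w & g = evalw w.

Lemma gen_by1 S : gen_by S 1.
Proof. by exists [::]. Qed.

Lemma gen_byM S g h : gen_by S g -> gen_by S h -> gen_by S (g * h).
Proof.
move=> [w Sw ->] [w' Sw' ->]; exists (w ++ w'); last by rewrite evalw_cat.
by rewrite all_cat Sw.
Qed.

Lemma gen_by_letter (S : pred V) l : S l.1 -> gen_by S (letter l).
Proof. by move=> Sl; exists [:: l] => //=; rewrite Sl. Qed.

Lemma evalw_inv w : evalw (inv_word w) = (evalw w)^-1.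
Proof.
apply: invg_inj; rewrite invgK; apply: mulg1_eq.
by rewrite -evalw_cat; apply/raag_pi/inv_word_catl.
Qed.

Lemma gen_byV S g : gen_by S g -> gen_by S g^-1.
Proof.
move=> [w Sw ->]; exists (inv_word w); last by rewrite evalw_inv.
by rewrite /inv_word all_rev all_map.
Qed.

Lemma sub_gen_by (S T : pred V) g : (forall v, S v -> T v) -> gen_by S g -> gen_by T g.
Proof.
by move=> ST [w Sw ->]; exists w => //; apply: sub_all Sw => l; apply: ST.
Qed.

Lemma gen_by_ind (S : pred V) (Q : G -> Prop) : Q 1 ->
  (forall l g, S l.1 -> gen_by S g -> Q g -> Q (letter l * g)) ->
  forall g, gen_by S g -> Q g.
Proof.
move=> Q1 QM g [w Sw ->{g}]; elim: w Sw => //= l w IH /andP[Sl Sw].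
rewrite evalw_cons; apply: QM => //; last exact: IH.
by exists w.
Qed.

Lemma commute_gen_by (S : pred V) (x g : G) : (forall u, S u -> commute x (gen u)) ->
  gen_by S g -> commute x g.
Proof.
move=> xS; apply: gen_by_ind => [|[v b] h Sv _ xh]; first exact: commute1.
by apply: commuteM xh; apply/commute_letter/xS.
Qed.

(** The retraction onto the subgroup generated by [S] that kills the other generators. *)
Definition retract (S : pred V) (g : G) : G :=
  evalw [seq l <- repr g | S l.1].

Lemma retract_evalw S w : retract S (evalw w) = evalw [seq l <- w | S l.1].
Proof.
suff H w1 w2 : raag_cong e w1 w2 ->
    raag_cong e [seq l <- w1 | S l.1] [seq l <- w2 | S l.1].
  by apply/raag_pi/H/raag_repr.
elim=> {w w1 w2} [w|w1 w2 _|w1 w2 w3 _ IH1 _|||u v uv].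
- exact: raag_refl.
- exact: raag_sym.
- exact: raag_trans.
- by move=> w1 w1' w2 w2' _ IH1 _ IH2; rewrite !filter_cat; apply: raag_cat.
- by move=> v b /=; case: (S v); [exact: raag_cancel|exact: raag_refl].
- by rewrite /=; case: (S u); case: (S v); rewrite //;
    try exact: raag_refl; exact: raag_comm.
Qed.

Lemma retractM S g h : retract S (g * h) = retract S g * retract S h.
Proof.
have [w ->] := evalwP g; have [w' ->] := evalwP h.
by rewrite -evalw_cat !retract_evalw filter_cat evalw_cat.
Qed.

Lemma retract1 S : retract S 1 = 1.
Proof. by rewrite -[1]/(evalw [::]) retract_evalw. Qed.

Lemma retractV S g : retract S g^-1 = (retract S g)^-1.
Proof. by apply/esym/mulg1_eq; rewrite -retractM mulgV retract1. Qed.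

Lemma retractJ S g h : retract S (g ^ h) = retract S g ^ retract S h.
Proof. by rewrite /conjg !retractM retractV. Qed.

Lemma retract_gen S v : retract S (gen v) = if S v then gen v else 1.
Proof. by rewrite -letter_true retract_evalw /=; case: (S v). Qed.

Lemma retract_id S g : gen_by S g -> retract S g = g.
Proof. by move=> [w Sw ->]; rewrite retract_evalw; congr evalw; apply/all_filterP. Qed.

Lemma gen_by_retract S g : gen_by S (retract S g).
Proof. by exists [seq l <- repr g | S l.1] => //; apply: filter_all. Qed.

Lemma gen_byI (S T : pred V) g : gen_by S g -> gen_by T g -> gen_by (predI S T) g.
Proof.
move=> [w Sw ->] /retract_id <-; rewrite retract_evalw.
exists [seq l <- w | T l.1] => //; rewrite all_filter.
by apply: sub_all Sw => l Sl; apply/implyP => Tl; rewrite /= Sl.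
Qed.

Definition sgnb (b : bool) : int := if b then 1%R else (-1)%R.

Lemma sgnbN b : sgnb (~~ b) = (- sgnb b)%R.
Proof. by case: b. Qed.

Definition exponent (v : V) (g : G) : int :=
  (\sum_(l <- repr g | l.1 == v) sgnb l.2)%R.

Lemma exponent_evalw v w :
  exponent v (evalw w) = (\sum_(l <- w | l.1 == v) sgnb l.2)%R.
Proof.
suff H w1 w2 : raag_cong e w1 w2 ->
    (\sum_(l <- w1 | l.1 == v) sgnb l.2 = \sum_(l <- w2 | l.1 == v) sgnb l.2)%R.
  exact/H/raag_repr.
elim=> {w w1 w2} [//|//|w1 w2 w3 _ -> _ //|||u u' _].
- by move=> w1 w1' w2 w2' _ IH1 _ IH2; rewrite !big_cat /= IH1 IH2.
- move=> u b; rewrite !big_cons big_nil /=; case: (u == v) => //.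
  by rewrite sgnbN addr0 subrr.
- by rewrite !big_cons big_nil /=; do 2!case: (_ == v).
Qed.

Lemma exponentM v g h : exponent v (g * h) = (exponent v g + exponent v h)%R.
Proof.
have [w ->] := evalwP g; have [w' ->] := evalwP h.
by rewrite -evalw_cat !exponent_evalw big_cat.
Qed.

Lemma exponent1 v : exponent v 1 = 0%R.
Proof. by rewrite -[1]/(evalw [::]) exponent_evalw big_nil. Qed.

Lemma exponentV v g : exponent v g^-1 = (- exponent v g)%R.
Proof.
by apply/eqP; rewrite -addr_eq0 -exponentM mulVg exponent1.
Qed.

Lemma exponentJ v g h : exponent v (g ^ h) = exponent v g.
Proof. by rewrite /conjg !exponentM exponentV addrCA addNr addr0. Qed.

Lemma exponent_gen u v : exponent v (gen u) = (u == v)%:R%R.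
Proof.
by rewrite -letter_true exponent_evalw big_cons big_nil /=; case: (u == v).
Qed.

(** With [h^-1] as exponent, left multiplication acts on the copies of the defining graph:
    conjugation by [k] carries copy [h] to copy [k^-1 * h]. *)
Definition vtx (h : G) (v : V) : G := gen v ^ h^-1.

Lemma vtx1 v : vtx 1 v = gen v.
Proof. by rewrite /vtx invg1 conjg1. Qed.

Lemma vtxM k h v : vtx (k * h) v = vtx h v ^ k^-1.
Proof. by rewrite /vtx invgM conjgM. Qed.

Lemma vtx_conj h v : vtx h v ^ h = gen v.
Proof. by rewrite /vtx conjgKV. Qed.

Lemma vtx_conjV k h v : vtx h v ^ k = vtx (k^-1 * h) v.
Proof. by rewrite vtxM invgK. Qed.

Lemma vtx_comm h s v : commute s (gen v) -> vtx (h * s) v = vtx h v.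
Proof.
move=> sv; rewrite vtxM; congr (_ ^ _).
by apply/conjg_commute/commuteV/commute_sym.
Qed.

Lemma vtx_eq h k v : vtx h v = vtx k v <-> commute (h^-1 * k) (gen v).
Proof.
split=> [E|sv].
  have : vtx h v ^ k = gen v by rewrite E vtx_conj.
  rewrite /vtx -conjgM => /conjg_fixP/commgP; exact: commute_sym.
by rewrite -(vtx_comm h sv) mulVKg.
Qed.

Lemma vtx_label h k u v : vtx h u = vtx k v -> u = v.
Proof.
move=> /(congr1 (exponent v)); rewrite !exponentJ !exponent_gen eqxx.
by case: eqP.
Qed.

Lemma vtx_commute h u v : commute (vtx h u) (vtx h v) <-> commute (gen u) (gen v).
Proof. exact: commuteJ. Qed.

Lemma ext_vertexP (x : G) : ext_vertex x <-> exists h v, x = vtx h v.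
Proof.
split=> [[v [g ->]]|[h [v ->]]]; last by exists v, h^-1.
by exists g^-1, v; rewrite /vtx invgK.
Qed.

Lemma ext_vertexJ (x h : G) : ext_vertex x -> ext_vertex (x ^ h).
Proof. by move=> [v [g ->]]; exists v, (g * h); rewrite conjgM. Qed.

Definition star (v : V) : pred V := fun u => (u == v) || e u v.

Lemma star_commute u v : star v u -> commute (gen u) (gen v).
Proof.
by case/orP => [/eqP->|]; [exact: commute_refl|exact: gen_commute].
Qed.

Lemma star_refl v : star v v.
Proof. by rewrite /star eqxx. Qed.

Lemma len_ind (Q : G -> Prop) :
  (forall g, (forall h, (len e_sym e_irr h < len e_sym e_irr g)%N -> Q h) -> Q g) ->
  forall g, Q g.
Proof.
move=> QS g; have [n] := ubnP (len e_sym e_irr g).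
elim: n g => // n IH g; rewrite ltnS => ng; apply: QS => h hg.
by apply: IH; apply: leq_trans hg ng.
Qed.

(** Final letters in the star of [v] are removed by induction. If none is left and [h] is not 1, it
    ends in some [c] outside the star. In [h * v] the stack of [c] is blocked, whereas in [v * h] it
    has [c] on top, unless a cancellation makes the product too short. *)
Lemma centralizer_gen h v : commute h (gen v) -> gen_by (star v) h.
Proof.
elim/len_ind: h => h IH hv.
have [[c [b [tc Sc]]]|ntop] := pselect (exists c b, top (stack h) c = Some b /\ star v c).
  have [h' [Eh lh _]] := top_factor e_sym e_irr tc.
  have clv : commute (letter (c, b)) (gen v).
    by apply/commute_sym/commute_letter/commute_sym/star_commute.
  rewrite Eh; apply: gen_byM; last exact: gen_by_letter.
  apply: IH; first by rewrite lh.
  rewrite -[h'](mulgK (letter (c, b))) -Eh.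
  by apply: commute_sym; apply: commuteM; [|apply: commuteV]; apply: commute_sym.
have [->|/eqP h1] := eqVneq h 1; first exact: gen_by1.
have [c [b tc]] := top_neq1 e_sym e_irr h1.
have Sc : ~~ star v c by apply/negP => Sc; case: ntop; exists c, b.
have tv : top (stack h) v <> Some (~~ true).
  by move=> tv; case: ntop; exists v, false; split => //; exact: star_refl.
have lhv := len_push e_sym e_irr tv.
have thv : top (stack (h * letter (v, true))) c = None.
  rewrite stack_letter // act_push //; move: Sc; rewrite /star negb_or => /andP[cv ecv].
  by apply: top_push_block => //; apply/eqP.
have [h' [Eh lh _]] := top_factor e_sym e_irr tc.
have E : h * letter (v, true) = letter (v, true) * h' * letter (c, b).
  by rewrite -mulgA -Eh.
have lvh := len_letterl e_sym e_irr h' (v, true).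
have [tp|/eqP tp] := eqVneq (top (stack (letter (v, true) * h')) c) (Some (~~ b)).
  have [h2 [E2 l2 _]] := top_factor e_sym e_irr tp.
  move: lhv; rewrite E E2 letterN mulgVK lh => El.
  by move: lvh; rewrite l2 El ltnS ltnNge leqnSn.
by move: thv; rewrite E stack_letter // act_push // (top_push e (c, b)).
Qed.

Lemma vtx_eq_gen_by h k v : vtx h v = vtx k v -> gen_by (star v) (h^-1 * k).
Proof. by move=> /vtx_eq /centralizer_gen. Qed.

(** The retraction onto [S] fixes the element and replaces [h] by its image; it cannot kill [v],
    since the exponent sum of [v] is 1. *)
Lemma gen_by_conj_gen (S : pred V) h v : gen_by S (vtx h v) ->
  exists2 k, gen_by S k & S v /\ vtx h v = vtx k v.
Proof.
move=> Sx; exists (retract S h); first exact: gen_by_retract.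
move: (retract_id Sx); rewrite /vtx retractJ retract_gen retractV.
case: (S v) => // /esym /(congr1 (exponent v)); rewrite conj1g exponentJ.
by rewrite exponent1 exponent_gen eqxx.
Qed.

(** Seen from copy [h], the vertex [y] lies in the subgroup generated by the star of [v], so it is a
    conjugate of a generator by an element of this subgroup, and such an element fixes [v]. *)
Lemma commute_common h v y : ext_vertex y -> commute (vtx h v) y ->
  exists k u, [/\ vtx h v = vtx k v, y = vtx k u & star v u].
Proof.
move=> /ext_vertexP [h' [u ->]]; rewrite -(commuteJ _ _ h) vtx_conj => /commute_sym.
rewrite vtx_conjV => /centralizer_gen /gen_by_conj_gen [k Sk [Su E]].
exists (h * k), u; split => //.
  apply/esym/vtx_comm/commute_sym; apply: commute_gen_by Sk => w /star_commute.
  exact: commute_sym.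
by rewrite vtxM -E -vtxM mulVKg.
Qed.

Lemma adj_common h v y : ext_vertex y -> y <> vtx h v -> commute (vtx h v) y ->
  exists k u, [/\ vtx h v = vtx k v, y = vtx k u & e v u].
Proof.
move=> Vy yx xy; have [k [u [Ex Ey]]] := commute_common Vy xy.
case/orP => [/eqP uv|uv]; last by exists k, u; rewrite e_sym.
by case: yx; rewrite Ey uv Ex.
Qed.

Lemma vtx_adj h u v : e u v -> commute (vtx h u) (vtx h v) /\ vtx h u <> vtx h v.
Proof.
move=> uv; split; first exact/vtx_commute/gen_commute.
by move/vtx_label => E; rewrite E e_irr in uv.
Qed.

Lemma vtx_same_label h k v : commute (vtx h v) (vtx k v) -> vtx k v = vtx h v.
Proof.
move=> c; apply: contrapT => n.
have Vk : ext_vertex (vtx k v) by apply/ext_vertexP; exists k, v.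
by have [k' [u [_ /vtx_label <-]]] := adj_common Vk n c; rewrite e_irr.
Qed.

End Retractions.

(** * Crossings *)

Section Crossings.
Variables (V : finType) (e : rel V).
Hypotheses (e_sym : symmetric e) (e_irr : irreflexive e).

Local Notation G := (raag e).
Local Notation word := (seq (V * bool)).
Local Notation gen := (raag_gen e).
Local Notation evalw := (@evalw V e).
Local Notation letter := (@letter V e).
Local Notation vtx := (@vtx V e).
Local Notation len := (len e_sym e_irr).

(** Moving [x] by each letter read brings the next hyperplane back to the base point, where crossing
    it is a comparison with a generator. *)
Fixpoint crossw (x : G) (w : word) : int :=
  if w is l :: w' then
    ((if gen l.1 == x then sgnb l.2 else 0) + crossw (x ^ letter l)%g w')%R
  else 0%R.

Lemma crossw_cat x w1 w2 :
  crossw x (w1 ++ w2) = (crossw x w1 + crossw (x ^ evalw w1)%g w2)%R.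
Proof.
elim: w1 x => [|l w1 IH] x; first by rewrite evalw_nil conjg1 add0r.
by rewrite /= IH addrA evalw_cons conjgM.
Qed.

Lemma crossw_cong w1 w2 : raag_cong e w1 w2 -> forall x, crossw x w1 = crossw x w2.
Proof.
elim=> {w1 w2} [//|w1 w2 _ IH x|w1 w2 w3 _ IH1 _ IH2 x
  |w1 w1' w2 w2' c1 IH1 _ IH2 x|v b x|u v uv x].
- by rewrite IH.
- by rewrite IH1.
- by rewrite !crossw_cat IH1 IH2; have /raag_pi := c1; rewrite -/(evalw _) => ->.
- rewrite /= addr0; have -> : (gen v == x ^ letter (v, b)) = (gen v == x).
    rewrite -[X in X == _](conjg_commute (commute_sym (letter_commute_gen e v b))).
    by rewrite (inj_eq (@conjg_inj _ _)).
  by case: eqP; rewrite ?sgnbN ?subrr.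
- rewrite /= !addr0 addrC; congr (_ + _)%R.
    rewrite -[X in X == _](conjg_commute (commute_sym (gen_commute uv))).
    by rewrite letter_true (inj_eq (@conjg_inj _ _)).
  rewrite letter_true.
  rewrite -[X in _ = (if X == _ then _ else _)](conjg_commute (gen_commute uv)).
  by rewrite (inj_eq (@conjg_inj _ _)).
Qed.

(** The number of times, counted with sign, that a path from [1] to [g] in the
    Cayley graph crosses the hyperplanes labelled by the vertex [x]. *)
Definition cross (x g : G) : int := crossw x (repr g).

Lemma cross_evalw x w : cross x (evalw w) = crossw x w.
Proof. exact/crossw_cong/raag_repr. Qed.

Lemma crossM x g h : cross x (g * h) = (cross x g + cross (x ^ g)%g h)%R.
Proof.
have [w ->] := evalwP g; have [w' ->] := evalwP h.
by rewrite -evalw_cat !cross_evalw crossw_cat.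
Qed.

Lemma cross1 x : cross x 1 = 0%R.
Proof. by rewrite -[1]/(evalw [::]) cross_evalw. Qed.

Lemma cross_letter x l : cross x (letter l) = if gen l.1 == x then sgnb l.2 else 0%R.
Proof. by rewrite cross_evalw /= addr0. Qed.

Lemma crossV x g : cross x g^-1 = (- cross (x ^ g^-1)%g g)%R.
Proof. by apply/eqP; rewrite -addr_eq0 -crossM mulVg cross1. Qed.

Lemma crossB x h k : (cross x k - cross x h)%R = cross (x ^ h) (h^-1 * k).
Proof. by rewrite -{1}[k](mulVKg h) crossM addrAC subrr add0r. Qed.

Lemma crossJ_eq x k g h :
  cross (x ^ k^-1) (k * g) = cross (x ^ k^-1) (k * h) <-> cross x g = cross x h.
Proof.
by rewrite !crossM conjgKV; split=> [/addrI|->].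
Qed.

Lemma crossw_neq0 x w : crossw x w <> 0%R ->
  exists p l q, w = p ++ l :: q /\ x = vtx (evalw p) l.1.
Proof.
elim: w x => [//|l w IH] x /=; case: eqP => [<- _|_].
  by exists [::], l, w; rewrite evalw_nil vtx1.
rewrite add0r => /IH [p [l' [q [-> E]]]]; exists (l :: p), l', q; split => //.
by rewrite evalw_cons vtxM -E conjgK.
Qed.

Lemma cross_gen_by (S : pred V) x g : gen_by S g -> cross x g <> 0%R ->
  exists k u, [/\ gen_by S k, S u & x = vtx k u].
Proof.
move=> [w Sw ->]; rewrite cross_evalw => /crossw_neq0 [p [l [q [Ew ->]]]].
move: Sw; rewrite Ew all_cat /= => /and3P[Sp Sl _].
by exists (evalw p), l.1; split => //; exists p.
Qed.

(** The vertex [x] belongs to the translate by [h] of the base copy of the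
    defining graph in the extension graph. *)
Definition in_copy (h x : G) : Prop := exists v, x = vtx h v.

Lemma in_copy_vtx h v : in_copy h (vtx h v).
Proof. by exists v. Qed.

Lemma in_copy_ext h x : in_copy h x -> ext_vertex x.
Proof. by move=> [v ->]; apply/ext_vertexP; exists h, v. Qed.

Lemma ext_in_copy x : ext_vertex x -> exists h, in_copy h x.
Proof. by move=> /ext_vertexP [h [v ->]]; exists h, v. Qed.

Lemma in_copyM k h x : in_copy h x -> in_copy (k * h) (x ^ k^-1).
Proof. by move=> [v ->]; exists v; rewrite vtxM. Qed.

Lemma in_copyJ k h x : in_copy h x -> in_copy (k^-1 * h) (x ^ k).
Proof. by move=> /(in_copyM k^-1); rewrite invgK. Qed.

Lemma commute_in_copy x y : ext_vertex x -> ext_vertex y -> commute x y ->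
  exists h, in_copy h x /\ in_copy h y.
Proof.
move=> /ext_vertexP [h [v ->]] Vy.
move=> /(commute_common e_sym e_irr Vy) [k [u [-> -> _]]].
by exists k; split; [exists v|exists u].
Qed.

(** Two copies of [y] differ by an element of the subgroup generated by a star, and all vertices
    crossed between them commute with [y]. *)
Lemma cross_const x y h k : in_copy h y -> in_copy k y -> ~ commute x y ->
  cross x h = cross x k.
Proof.
move=> [v Ev] [v' Ev'] xy; apply: contrapT => /eqP; rewrite eq_sym -subr_eq0 crossB.
have Evv := Ev'; rewrite Ev in Evv; have vv := vtx_label Evv; subst v'.
move=> /eqP /(cross_gen_by (vtx_eq_gen_by e_sym e_irr Evv)) [p [u [Sp Su E]]].
apply: xy; rewrite Ev -(commuteJ _ _ h) vtx_conj E.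
have cvp : commute (gen v) p.
  by apply: commute_gen_by Sp => w Sw; apply/commute_sym/star_commute.
by rewrite -(commuteJ _ _ p) vtx_conj (conjg_commute cvp); apply: star_commute.
Qed.

(** Consecutive vertices share a copy, so a change of [cross x] has to occur between two copies of
    one vertex, and [cross_const] applies to it. *)
Lemma path_commute x p y h k :
  path (@ext_adj V e) y p -> in_copy h y -> in_copy k (last y p) ->
  cross x h <> cross x k -> exists2 q, q \in y :: p & commute x q.
Proof.
elim: p y h => [|z p IH] y h /= => [_ hy ky xhk|/andP[/asboolP[_ Vz _ yz] pz] hy kp xhk].
  exists y; rewrite ?mem_head //; apply: contrapT => nc; exact/xhk/(cross_const hy ky).
have [k' [hy' hz]] := commute_in_copy (in_copy_ext hy) Vz yz.
have [/eqP E|/eqP E] := boolP (cross x h == cross x k').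
  have xk'k : cross x k' <> cross x k by rewrite -E.
  have [q qp xq] := IH z k' pz hz kp xk'k.
  by exists q => //; rewrite inE qp orbT.
exists y; rewrite ?mem_head //; apply: contrapT => nc; exact/E/(cross_const hy hy').
Qed.

(** If [x] is passed on the way from [h] to [y], and [y] on the way from [h] to
    [x], then look at the one whose copies are closer to [h]. *)
Lemma cross_nested x y h hx hy : in_copy hx x -> in_copy hy y -> ~ commute x y ->
  cross x h = cross x hy \/ cross y h = cross y hx.
Proof.
move=> xhx yhy nxy.
pose Q n := `[< exists2 k, in_copy k x \/ in_copy k y & len (h^-1 * k) = n >].
have exQ : exists n, Q n.
  by exists (len (h^-1 * hx)); apply/asboolP; exists hx => //; left.
have [n /asboolP [k ck lk] nmin] := ex_minnP exQ.
(* If [z] were crossed on a shortest word from [h] to [k], the crossing would give a copy of [x] or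
   [y] closer to [h]. *)
have key z : (forall k', in_copy k' z -> in_copy k' x \/ in_copy k' y) ->
    cross z h = cross z k.
  move=> Cz; apply: contrapT => /eqP; rewrite eq_sym -subr_eq0 crossB.
  rewrite -[h^-1 * k](evalw_nform e_sym e_irr) cross_evalw => /eqP.
  move=> /crossw_neq0 [p [l [q [Ew Ez]]]].
  have Cp : in_copy (h * evalw p) z by exists l.1; rewrite vtxM -Ez conjgK.
  have /nmin : Q (len (h^-1 * (h * evalw p))).
    by apply/asboolP; exists (h * evalw p) => //; apply: Cz.
  rewrite mulKg => /leq_trans /(_ (len_evalw _ _ _)); rewrite -lk /len Ew.
  by rewrite size_cat /= addnS ltnNge leq_addr.
case: ck => ck.
  right; rewrite (key y); last by move=> *; right.
  by apply: cross_const ck xhx _ => /commute_sym.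
by left; rewrite (key x); [apply: cross_const ck yhy _|move=> *; left].
Qed.

(** The exponent of the last syllable of a vertex, made of the letters above the first block. *)
Fixpoint runsum (s : seq (option bool)) : int :=
  if s is Some b :: s' then (sgnb b + runsum s')%R else 0%R.

(** Adjacent letters of a run have the same sign, as they would cancel otherwise; so their sum does
    not vanish. *)
Lemma runsum_top (g : G) v b : top (stack g) v = Some b -> (0 < sgnb b * runsum (stack g v))%R.
Proof.
elim/(@len_ind _ _ e_sym e_irr): g => g IH tv.
have [g' [Eg lg ts]] := top_factor e_sym e_irr tv.
have -> : stack g v = Some b :: stack g' v.
  by rewrite Eg stack_letter // act_push // /push /= eqxx.
rewrite /= mulrDr; have -> : (sgnb b * sgnb b = 1)%R by case: (b).
case E: (stack g' v) => [|[c|] s]; rewrite ?mulr0 ?addr0 //.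
have Ec : c = b.
  by move: ts; rewrite /top E /=; case: (c); case: (b) => // -[].
have := IH g'; rewrite lg ltnSn => /(_ isT); rewrite /top E /= Ec => /(_ erefl).
by move=> ?; apply: addr_gt0.
Qed.

(** A letter in the star of [v] changes both sides equally. If the crossing number is nonzero, a
    proper prefix of the normal form has the same vertex [vtx g v] and differs from [g] by such
    letters; if it is zero, a final letter [v] can be removed, or both sides vanish. *)
Lemma cross_runsum (g : G) v : cross (vtx g v) g = runsum (stack g v).
Proof.
have step g' l : star e v l.1 -> (cross (vtx g' v) g' = runsum (stack g' v) <->
    cross (vtx (g' * letter l) v) (g' * letter l) = runsum (stack (g' * letter l) v)).
  case: l => u b Su /=; have cl : commute (letter (u, b)) (gen v).
    by apply/commute_sym/commute_letter/commute_sym/star_commute.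
  rewrite (vtx_comm _ cl) crossM vtx_conj cross_letter stack_letter //=.
  have -> : runsum (act e (stack g') (u, b) v) =
      (runsum (stack g' v) + (if gen u == gen v then sgnb b else 0))%R.
    have [->|nuv] := eqVneq u v.
      rewrite eqxx; have [tv|/eqP tv] := eqVneq (top (stack g') v) (Some (~~ b)).
        rewrite /act /= tv eqxx /pop eqxx /=; move: tv; rewrite /top.
        case: (stack g' v) => // _ s /= ->; rewrite /= sgnbN addrAC addNr add0r //.
      by rewrite act_push // /push eqxx /= addrC.
    have -> : (gen u == gen v) = false.
      by apply/eqP; rewrite -!(vtx1 e) => /vtx_label /eqP; rewrite (negPf nuv).
    have evu : e v u.
      by move: Su; rewrite /star (negPf nuv) e_sym.
    rewrite addr0 /act /=; case: eqP => _; last by rewrite stack_push_comm.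
    by rewrite /pop eq_sym (negPf nuv) evu.
  by split=> [->//|/addIr].
have back g' k : gen_by (star e v) (g'^-1 * k) ->
    cross (vtx g' v) g' = runsum (stack g' v) ->
    cross (vtx k v) k = runsum (stack k v).
  move=> [w Sw E] H; have -> : k = g' * evalw w by rewrite -E mulVKg.
  elim/last_ind: w Sw {E} => [|w l IH]; first by rewrite mulg1.
  by rewrite all_rcons => /andP[Sl Sw]; rewrite evalw_rcons mulgA -(step _ _ Sl); apply: IH.
elim/(@len_ind _ _ e_sym e_irr): g => g IH.
have [/eqP E|/eqP] := boolP (cross (vtx g v) g == 0%R).
  case Et: (top (stack g) v) => [b|].
    have [g' [Eg lg _]] := top_factor e_sym e_irr Et.
    by rewrite Eg -step ?star_refl //; apply: IH; rewrite lg.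
  by rewrite E; move: Et; rewrite /top; case: (stack g v) => [|[]].
rewrite -{2}(evalw_nform e_sym e_irr g) cross_evalw => /crossw_neq0 [p [l [q [Ew Ex]]]].
have lv := vtx_label Ex; rewrite -lv in Ex.
apply: (back (evalw p)); first exact/(vtx_eq_gen_by e_sym e_irr)/esym.
apply: IH; apply: leq_ltn_trans (len_evalw _ _ _) _.
by rewrite /len Ew size_cat /= addnS ltnS leq_addr.
Qed.

Lemma cross_top (g : G) v b : top (stack g) v = Some b -> cross (vtx g v) g <> 0%R.
Proof.
by move=> /runsum_top; rewrite cross_runsum => + E; rewrite E mulr0 ltxx.
Qed.

Lemma top_gen_by (S : pred V) (g : G) v b : gen_by S g -> top (stack g) v = Some b -> S v.
Proof.
move=> Sg /cross_top /(cross_gen_by Sg) [k [u [_ Su E]]].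
by rewrite (vtx_label E).
Qed.

End Crossings.

(** * Cycles of length less than six in the extension graph *)

Section ShortCycles.
Variables (V : finType) (e : rel V).
Hypotheses (e_sym : symmetric e) (e_irr : irreflexive e).

Local Notation G := (raag e).
Local Notation gen := (raag_gen e).
Local Notation letter := (@letter V e).
Local Notation vtx := (@vtx V e).
Local Notation len := (len e_sym e_irr).
Local Notation adj := (@ext_adj V e).

Lemma ext_adjP (x y : G) :
  reflect [/\ ext_vertex x, ext_vertex y, x <> y & commute x y] (adj x y).
Proof. exact: asboolP. Qed.

Lemma ext_adj_sym : symmetric adj.
Proof.
by move=> x y; apply/ext_adjP/ext_adjP => -[? ? n c]; split;
  rewrite // /commute ?c // => E; exact: n.
Qed.

Lemma ext_adjJ (x y h : G) : adj (x ^ h) (y ^ h) = adj x y.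
Proof.
apply/ext_adjP/ext_adjP => -[Vx Vy n c]; split.
- by rewrite -(conjgK h x); apply: ext_vertexJ.
- by rewrite -(conjgK h y); apply: ext_vertexJ.
- by move=> E; apply: n; rewrite E.
- by move/commuteJ: c.
- exact: ext_vertexJ.
- exact: ext_vertexJ.
- by move/conjg_inj.
- exact/commuteJ.
Qed.

Lemma adj_vtx h u v : e u v -> adj (vtx h u) (vtx h v).
Proof.
move=> uv; have [c n] := vtx_adj e_irr h uv.
by apply/ext_adjP; split => //; apply/ext_vertexP; [exists h, u|exists h, v].
Qed.

Lemma adj_vtxP x y : adj x y -> exists h u v, [/\ x = vtx h u, y = vtx h v & e u v].
Proof.
move=> /ext_adjP [/ext_vertexP [h [u Ex]] Vy n c].
have nyx : y <> vtx h u by move=> E; apply: n; rewrite E.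
rewrite Ex in c; have [k [v [Eu Ey uv]]] := adj_common e_sym e_irr Vy nyx c.
by exists k, u, v; rewrite Ex.
Qed.

Lemma adj_vtxl h u y : adj (vtx h u) y ->
  exists k v, [/\ vtx h u = vtx k u, y = vtx k v & e u v].
Proof.
move=> /adj_vtxP [k [u' [v [E -> uv]]]]; have Eu := vtx_label E; subst u'.
by exists k, v.
Qed.

Lemma adj_in_copy h u v : adj (vtx h u) (vtx h v) -> e u v.
Proof.
move=> /adj_vtxl [k [w [_ /vtx_label ->]]] //.
Qed.

Hypotheses (e_tri : forall a b c, e a b -> e b c -> e c a -> False)
  (e_sq : forall a b c d, e a b -> e b c -> e c d -> e d a -> a <> c -> b = d)
  (e_pent : forall a b c d f, e a b -> e b c -> e c d -> e d f -> e f a -> False).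

Lemma star_sym u v : star e u v = star e v u.
Proof. by rewrite /star eq_sym e_sym. Qed.

Lemma star_clique u v c d : u <> v -> star e u c -> star e v c ->
  star e u d -> star e v d -> star e c d.
Proof.
move=> uv uc vc ud vd.
case/orP: (uc) => [/eqP->//|cu]; case/orP: (vc) => [/eqP->//|cv].
case/orP: (ud) => [/eqP->|du]; first by rewrite star_sym.
case/orP: (vd) => [/eqP->|dv]; first by rewrite star_sym.
have -> : c = d by apply: (@e_sq u c v d) => //; rewrite e_sym.
exact: star_refl.
Qed.

(** The conjugate of [z] by [h] lies in the subgroup generated by the common star of [u] and [v].
    Without squares this star is a clique, so the subgroup is abelian and the conjugate is itself a
    generator. *)
Lemma common_vtx h u v z : ext_vertex z -> u <> v -> commute (vtx h u) z ->
  commute (vtx h v) z -> exists2 c, z = vtx h c & star e u c /\ star e v c.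
Proof.
move=> Vz uv.
rewrite -(commuteJ _ _ h) -[X in _ -> X -> _](commuteJ _ _ h) !vtx_conj.
move=> /commute_sym /(centralizer_gen e_sym e_irr) cu.
move=> /commute_sym /(centralizer_gen e_sym e_irr) /(gen_byI cu) {cu}.
have /ext_vertexP [k [c Ez]] := ext_vertexJ h Vz; rewrite Ez.
move=> /gen_by_conj_gen [k' Sk' [/andP[/= uc vc] Ek]].
exists c => //; have Ec : z ^ h = gen c.
  rewrite Ez Ek -[k']mul1g vtx_comm ?vtx1 //.
  apply/commute_sym; apply: commute_gen_by Sk' => w /andP[/= uw vw].
  by apply: commute_sym; apply: star_commute; apply: (star_clique uv).
by rewrite /vtx -Ec conjgK.
Qed.

Lemma no_triangle x y z : adj x y -> ext_vertex z -> commute z x -> commute z y ->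
  z = x \/ z = y.
Proof.
move=> /adj_vtxP [h [u [v [-> -> uv]]]] Vz /commute_sym zx /commute_sym zy.
have nuv : u <> v by move=> E; rewrite E e_irr in uv.
have [c -> [/orP[/eqP->|cu] /orP[/eqP->|cv]]] := common_vtx Vz nuv zx zy; auto.
by have := e_tri uv; rewrite e_sym in cv => /(_ _ cv cu).
Qed.

(** Final letters of [h^-1 * h'] that fix both [x] and [a'] are absorbed into [h']. If a final
    letter [c] remains, [vtx h' c] is a neighbour of [x] crossed on the way from [h] to [h']: it
    separates [a] from [a'], or it is [a] itself and [h'] is a common copy. *)
Lemma link_separation x a a' h h' : adj x a -> adj x a' ->
    in_copy h x -> in_copy h a -> in_copy h' x -> in_copy h' a' ->
  (exists k, [/\ in_copy k x, in_copy k a & in_copy k a']) \/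
  (exists z k, [/\ adj x z, z <> a, z <> a', [/\ in_copy k x, in_copy k a' & in_copy k z]
    & cross z h <> cross z k]).
Proof.
move=> xa xa' [v Ex] [u Ea] hx' ha'.
have [r Er] : exists r, r = h^-1 * h' by exists (h^-1 * h').
elim/(@len_ind _ _ e_sym e_irr): r h' Er hx' ha' => r IH h' Er [v' Ex'] [u' Ea'].
have vv : v' = v by apply: (@vtx_label _ _ h' h); rewrite -Ex -Ex'.
subst v'; have vu : e v u by move: xa; rewrite Ex Ea => /adj_in_copy.
have vu' : e v u' by move: xa'; rewrite Ex' Ea' => /adj_in_copy.
have cv : gen_by (star e v) r by rewrite Er; apply: vtx_eq_gen_by; rewrite -?Ex.
have [r1|/eqP/(top_neq1 e_sym e_irr) [c [b tc]]] := eqVneq r 1.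
  have hh : h = h' by rewrite -[h]mulg1 -r1 Er mulVKg.
  by left; exists h; split; [exists v|exists u|exists u'; rewrite hh].
have [cvu|] := boolP ((c == v) || (c == u')).
  have [r' [Er' lr _]] := top_factor e_sym e_irr tc.
  have cl w : w = v \/ w = u' -> commute (letter (c, b))^-1 (gen w).
    move=> wvu; apply/commute_sym/commuteV/commute_letter/star_commute.
    have E v1 u1 : e v1 u1 -> star e v1 u1 by rewrite /star e_sym => ->; rewrite orbT.
    by case/orP: cvu => /eqP->; case: wvu => ->; rewrite ?star_refl ?E // e_sym.
  apply: (IH r' _ (h' * (letter (c, b))^-1)).
  - by rewrite lr.
  - by rewrite mulgA -Er Er' mulgK.
  - by exists v; rewrite vtx_comm //; apply: cl; left.
  - by exists u'; rewrite vtx_comm //; apply: cl; right.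
rewrite negb_or => /andP[ncv ncu'].
have vc : e v c.
  by have := top_gen_by e_sym e_irr cv tc; rewrite /star (negPf ncv) e_sym.
have [za|za] := pselect (vtx h' c = a).
  by left; exists h'; split; [exists v|exists c|exists u'].
right; exists (vtx h' c), h'; split.
- by rewrite Ex'; apply: adj_vtx.
- by [].
- by rewrite Ea' => /vtx_label /eqP; rewrite (negPf ncu').
- by split; [exists v|exists u'|exists c].
have := cross_top e_sym e_irr tc.
by rewrite Er -vtx_conjV -crossB => n E; apply: n; rewrite E subrr.
Qed.

Lemma adj_neq x y : adj x y -> x <> y.
Proof. by case/ext_adjP. Qed.

Lemma adj_commute x y : adj x y -> commute x y.
Proof. by case/ext_adjP. Qed.

Lemma adj_vertex x y : adj x y -> ext_vertex y.
Proof. by case/ext_adjP. Qed.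

Lemma adj_copy x y : adj x y -> exists h, in_copy h x /\ in_copy h y.
Proof.
by move=> /adj_vtxP [h [u [v [-> -> _]]]]; exists h; split; apply: in_copy_vtx.
Qed.

Lemma link_antichain x a a' : adj x a -> adj x a' -> a <> a' -> ~ commute a a'.
Proof.
move=> xa xa' n c.
have [E|E] := no_triangle xa (adj_vertex xa') (commute_sym (adj_commute xa')) (commute_sym c).
  by apply: (adj_neq xa').
exact: n.
Qed.

(** In a common copy of [a] and [a'] the claim follows from the defining graph. Otherwise a
    neighbour [z] of [x] separates them, the path through [y] must meet the star of [z] at [y], and
    [a] can be replaced by [z], which shares a copy with [a']. *)
Lemma no_square x a a' y : adj x a -> adj x a' -> a <> a' -> ext_vertex y ->
  commute y a -> commute y a' -> y = x.
Proof.
move=> xa xa' naa' Vy ya ya'.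
have copy k b b' : in_copy k x -> in_copy k b -> in_copy k b' -> b <> b' ->
    adj x b -> adj x b' -> commute y b -> commute y b' -> y = x.
  move=> [v Ex] [u Eb] [u' Eb'] nbb' xb xb' yb yb'.
  have nuu' : u <> u' by move=> E; apply: nbb'; rewrite Eb Eb' E.
  rewrite Eb in yb; rewrite Eb' in yb'.
  have [c Ey [cu cu']] := common_vtx Vy nuu' (commute_sym yb) (commute_sym yb').
  rewrite Ex Eb in xb; rewrite Ex Eb' in xb'.
  have vu := adj_in_copy xb; have vu' := adj_in_copy xb'.
  have [cv|/eqP ncv] := eqVneq c v; first by rewrite Ey Ex cv.
  have cv : e c v.
    have : star e v c.
      by apply: (star_clique nuu' _ _ cu cu'); rewrite /star ?vu ?vu' orbT.
    by case/orP=> // /eqP.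
  case/orP: cu => [/eqP E|cu]; last by case: (e_tri cv vu); rewrite e_sym.
  case/orP: cu' => [/eqP E'|cu']; first by case: nuu'; rewrite -E -E'.
  by case: (e_tri cv vu'); rewrite e_sym.
have [h [hx ha]] := adj_copy xa; have [h' [hx' ha']] := adj_copy xa'.
case: (link_separation xa xa' hx ha hx' ha') => [[k [kx ka ka']]|].
  exact: (copy k a a').
move=> [z [k [xz nza nza' [kx ka' kz] zhk]]].
apply: (copy k a' z) => //; first by move=> E; apply: nza'.
apply: contrapT => nyz.
have [k1 [k1a k1y]] := commute_in_copy e_sym e_irr (adj_vertex xa) Vy (commute_sym ya).
have [k2 [k2y k2a']] := commute_in_copy e_sym e_irr Vy (adj_vertex xa') ya'.
apply: zhk; rewrite (cross_const e_sym e_irr ha k1a); last exact: link_antichain xz xa nza.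
rewrite (cross_const e_sym e_irr k1y k2y); last by move=> c; apply: nyz; apply: commute_sym.
by apply: (cross_const e_sym e_irr k2a' ka'); apply: link_antichain xz xa' nza'.
Qed.

Lemma adj_symW x y : adj x y -> adj y x.
Proof. by rewrite ext_adj_sym. Qed.

(** A neighbour [z] of [x] separating [a] from [a'] would commute with a vertex of the path [a],
    [y], [y'], [a']; the ends are excluded by the absence of triangles, the inner vertices by the
    absence of squares. *)
Lemma pentagon_corner x a a' y y' : adj x a -> adj x a' -> a <> a' ->
  adj a y -> adj a' y' -> adj y y' -> y <> x -> y' <> x ->
  exists k, [/\ in_copy k x, in_copy k a & in_copy k a'].
Proof.
move=> xa xa' naa' ay ay' yy' nyx ny'x.
have [h [hx ha]] := adj_copy xa; have [h' [hx' ha']] := adj_copy xa'.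
case: (link_separation xa xa' hx ha hx' ha') => [//|].
move=> [z [k [xz nza nza' [kx ka' kz] zhk]]].
have p : path adj a [:: y; y'; a'].
  by rewrite /= ay yy' ext_adj_sym ay'.
have [q] := path_commute e_sym e_irr p ha ka' zhk.
rewrite !inE => /or4P[] /eqP-> zq.
- by case: (link_antichain xz xa nza).
- case: nyx; apply: (no_square xa xz) (adj_vertex ay) _ (commute_sym zq).
    by move=> E; apply: nza.
  exact/commute_sym/adj_commute.
- case: ny'x; apply: (no_square xa' xz) (adj_vertex ay') _ (commute_sym zq).
    by move=> E; apply: nza'.
  exact/commute_sym/adj_commute.
- by case: (link_antichain xz xa' nza').
Qed.

Lemma gen_by_edge u v (r : G) : e u v -> gen_by (predU (pred1 u) (pred1 v)) r ->
  exists r1 r2, [/\ r = r1 * r2, gen_by (pred1 u) r1 & gen_by (pred1 v) r2].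
Proof.
move=> uv; move: r; apply: gen_by_ind.
  by exists 1, 1; rewrite mulg1; split=> //; apply: gen_by1.
move=> [w b] r /orP[] /eqP /= -> _ [r1 [r2 [-> g1 g2]]].
  exists (letter (u, b) * r1), r2; split=> //; first by rewrite mulgA.
  by apply: gen_byM g1; apply: gen_by_letter; rewrite /= eqxx.
exists r1, (letter (v, b) * r2); split=> //; last first.
  by apply: gen_byM g2; apply: gen_by_letter; rewrite /= eqxx.
rewrite !mulgA; congr (_ * _); apply: commute_gen_by g1 => _ /eqP->.
by apply/commute_sym/commute_letter/gen_commute.
Qed.

(** The corners at [x] and [a'] lie in copies [k0] and [k1] that differ by a product [r1 * r2] from
    the subgroups of their two labels. The copy [k0 * r1] contains both corners, then also [y] by
    [common_vtx], and so a pentagon of the defining graph. *)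
Lemma no_pentagon x a a' y y' : adj x a -> adj x a' -> a <> a' ->
  adj a y -> adj a' y' -> adj y y' -> y <> x -> y' <> x -> False.
Proof.
move=> xa xa' naa' ay ay' yy' nyx ny'x.
have nya' : y <> a'.
  by move=> E; apply: (link_antichain xa xa' naa'); rewrite -E; apply: adj_commute.
have [k0 [[v Ex] [u Ea] [u' Ea']]] := pentagon_corner xa xa' naa' ay ay' yy' nyx ny'x.
have nxy' : x <> y' by move=> E; apply: ny'x.
have [k1 [[u1 Ea1] [v1 Ex1] [c Ey']]] := pentagon_corner (adj_symW xa') ay' nxy' xa
  (adj_symW yy') ay naa' nya'.
have E1 : u' = u1 by apply: (@vtx_label _ _ k0 k1); rewrite -Ea' -Ea1.
have E2 : v = v1 by apply: (@vtx_label _ _ k0 k1); rewrite -Ex -Ex1.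
subst u1 v1.
have vu : e v u by move: xa; rewrite Ex Ea => /adj_in_copy.
have vu' : e v u' by move: xa'; rewrite Ex Ea' => /adj_in_copy.
have u'c : e u' c by move: ay'; rewrite Ea1 Ey' => /adj_in_copy.
have gv : gen_by (star e v) (k0^-1 * k1) by apply: vtx_eq_gen_by; rewrite -?Ex -?Ex1.
have gu : gen_by (star e u') (k0^-1 * k1) by apply: vtx_eq_gen_by; rewrite -?Ea' -?Ea1.
have [r1 [r2 [Er g1 g2]]] : exists r1 r2, [/\ k0^-1 * k1 = r1 * r2,
    gen_by (pred1 v) r1 & gen_by (pred1 u') r2].
  apply: gen_by_edge => //; apply: sub_gen_by (gen_byI gv gu) => w /andP[wv wu].
  case/orP: wv => [/eqP->|wv]; first by rewrite /= eqxx.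
  case/orP: wu => [/eqP->|wu]; first by rewrite /= eqxx orbT.
  by case: (e_tri wv vu'); rewrite e_sym.
have Ek : k0 * r1 = k1 * r2^-1 by rewrite -[k1](mulVKg k0) Er mulgA mulgK.
have Ea2 : a = vtx (k0 * r1) u.
  rewrite vtx_comm //; apply: commute_sym; apply: commute_gen_by g1 => _ /eqP->.
  by apply: gen_commute; rewrite e_sym.
have Ey2 : y' = vtx (k0 * r1) c.
  rewrite Ek vtx_comm //; apply/commute_sym/commuteV.
  by apply: commute_gen_by g2 => _ /eqP->; apply: gen_commute; rewrite e_sym.
have nuc : u <> c.
  move=> E; apply: (link_antichain xa xa' naa'); rewrite Ea2 E -Ey2.
  exact/commute_sym/adj_commute.
have c1 := adj_commute ay; have c2 := commute_sym (adj_commute yy').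
rewrite Ea2 in c1; rewrite Ey2 in c2.
have [d Ed _] := common_vtx (adj_vertex ay) nuc c1 c2.
have ud : e u d by move: ay; rewrite Ea2 Ed => /adj_in_copy.
have dc : e d c by move: yy'; rewrite Ed Ey2 => /adj_in_copy.
by apply: (e_pent vu ud dc _ (_ : e u' v)); rewrite e_sym.
Qed.

End ShortCycles.

(** * Slices *)

Section Slices.
Variables (V : finType) (e : rel V).
Hypotheses (e_sym : symmetric e) (e_irr : irreflexive e).

Local Notation G := (raag e).
Local Notation gen := (raag_gen e).
Local Notation evalw := (@evalw V e).
Local Notation letter := (@letter V e).
Local Notation vtx := (@vtx V e).
Local Notation adj := (@ext_adj V e).
Local Notation X := (@ext_vertex V e).
Local Notation d := (graph_dist adj).

Hypothesis (e_conn : forall u v, connect e u v).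

Lemma walk_same_copy h u v : exists p, walk adj (vtx h u) (vtx h v) p.
Proof.
have /connectP [p up ->] := e_conn u v.
exists [seq vtx h w | w <- p]; split; last by rewrite last_map.
by rewrite path_map; apply: sub_path up => a b; apply: adj_vtx.
Qed.

(** The copies at the two ends of an edge of the Cayley graph share the vertex labelled by the
    letter. *)
Lemma walk_base h u v : exists p, walk adj (vtx 1 u) (vtx h v) p.
Proof.
have [w ->] := evalwP h; elim/last_ind: w v => [|w l IH] v.
  by rewrite evalw_nil; apply: walk_same_copy.
rewrite evalw_rcons; have [p wp] := IH l.1.
have [q wq] := walk_same_copy (evalw w * letter l) l.1 v.
have cl : commute (letter l) (gen l.1).
  by case: (l) => c b; apply: letter_commute_gen.
by exists (p ++ q); apply: walk_cat wp _; rewrite -(vtx_comm _ cl).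
Qed.

Lemma ext_walk x y : X x -> X y -> exists p, walk adj x y p.
Proof.
move=> /ext_vertexP [h [u ->]] /ext_vertexP [k [v ->]].
have [p wp] := walk_base h u u; have [q wq] := walk_base k u v.
have [p' wp' _] := walk_rev (@ext_adj_sym V e) wp.
by exists (p' ++ q); apply: walk_cat wp' wq.
Qed.

Let dP := graph_distP ext_walk.
Let d0 := graph_dist_eq0 ext_walk.
Let dC := graph_distC (@ext_adj_sym V e) ext_walk.
Let dD := graph_distD ext_walk.
Let d_pred := graph_dist_pred (@adj_vertex V e) ext_walk.
Let d_eq1 := graph_dist_eq1 (@ext_adj_sym V e) (@adj_vertex V e) ext_walk.

Lemma dist_commute x y : X x -> X y -> commute x y -> d x y <= 1.
Proof.
move=> Vx Vy c; have [->|/eqP n] := eqVneq x y; first by rewrite graph_distxx.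
by apply: graph_dist_adj; apply/ext_adjP.
Qed.

Lemma walkJ x y p h : walk adj x y p -> walk adj (x ^ h) (y ^ h) [seq z ^ h | z <- p].
Proof.
move=> [xp <-]; split; last exact: (last_map (fun z => z ^ h)).
rewrite (@path_map _ _ (fun z => z ^ h)).
by apply: sub_path xp => a b; rewrite /= ext_adjJ.
Qed.

Lemma distJ x y h : X x -> X y -> d (x ^ h) (y ^ h) = d x y.
Proof.
move=> Vx Vy; apply/eqP; rewrite eqn_leq; apply/andP; split.
  have [p wp <-] := dP Vx Vy.
  by rewrite -(size_map (fun z => z ^ h)); apply/graph_dist_le; apply: walkJ.
have [p wp <-] := dP (ext_vertexJ h Vx) (ext_vertexJ h Vy).
rewrite -(size_map (fun z => z ^ h^-1)); apply: graph_dist_le.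
by have := walkJ h^-1 wp; rewrite !conjgK.
Qed.

Hypotheses (e_tri : forall a b c, e a b -> e b c -> e c a -> False)
  (e_sq : forall a b c d, e a b -> e b c -> e c d -> e d a -> a <> c -> b = d)
  (e_pent : forall a b c d f, e a b -> e b c -> e c d -> e d f -> e f a -> False).

(** The neighbours [a] of [x] such that, seen from any other neighbour of [x], [a]
    lies on the same side as [h0]. *)
Definition slice (x h0 a : G) : Prop :=
  adj x a /\ forall z h, adj x z -> z <> a -> in_copy h a -> cross z h0 = cross z h.

(** Both points are on the side of [h0] of every other neighbour of [x], so none separates them;
    hence they share a copy, in which the label determines the vertex. *)
Lemma slice_inj x h0 k k' u : slice x h0 (vtx k u) -> slice x h0 (vtx k' u) ->
  vtx k u = vtx k' u.
Proof.
set a := vtx k u; set a' := vtx k' u.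
move=> [xa Sa] [xa' Sa']; apply: contrapT => naa'.
have [h [hx ha]] := adj_copy e_sym e_irr xa; have [h' [hx' ha']] := adj_copy e_sym e_irr xa'.
case: (link_separation e_sym e_irr xa xa' hx ha hx' ha') => [[l [_ [w Ea] [w' Ea']]]|].
  by apply: naa'; rewrite Ea Ea' -(vtx_label Ea) -(vtx_label Ea').
move=> [z [l [xz nza nza' [_ la' _]]]]; apply.
by rewrite -(Sa z h) // -(Sa' z l).
Qed.

Lemma slice_card x h0 (l : seq G) : X x -> uniq l -> (forall a, a \in l -> slice x h0 a) ->
  size l <= max_degree e.
Proof.
move=> /ext_vertexP [k [v Ex]] ul Sl.
have lab a : exists u, a \in l -> e v u /\ exists h, a = vtx h u.
  have [/Sl [xa _]|_] := boolP (a \in l); last by exists v.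
  have := xa; rewrite Ex => /(adj_vtxl e_sym e_irr) [h [u [_ -> vu]]].
  by exists u => _; split=> //; exists h.
pose f a := sval (cid (lab a)).
have fP a : a \in l -> e v (f a) /\ exists h, a = vtx h (f a) := svalP (cid (lab a)).
rewrite -(size_map f).
have /card_uniqP <- : uniq (map f l).
  rewrite map_inj_in_uniq // => a a' al al' E.
  have [_ [h Ea]] := fP a al; have [_ [h' Ea']] := fP a' al'.
  rewrite Ea Ea' E; apply: (@slice_inj x h0); last by rewrite -Ea'; apply: Sl.
  by rewrite -E -Ea; apply: Sl.
apply: leq_trans (_ : #|[set w | e v w]%SET| <= _); last first.
  exact: (leq_bigmax v).
apply: subset_leq_card; apply/fintype.subsetP => u /mapP [a al ->].
by rewrite inE; case: (fP a al).
Qed.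

Lemma sliceJ x h0 a k : slice x h0 a -> slice (x ^ k) (k^-1 * h0) (a ^ k).
Proof.
move=> [xa Sa]; split=> [|z h]; first by rewrite ext_adjJ.
move=> xz nza ha; apply/(crossJ_eq z k); rewrite mulVKg; apply: Sa.
- by rewrite -(ext_adjJ _ _ k) conjgKV.
- by move=> E; apply: nza; rewrite -E conjgKV.
- by have := in_copyM k ha; rewrite conjgK.
Qed.

Lemma slice_past x h0 h1 a : (forall z, adj x z -> cross z h0 = cross z h1) ->
  slice x h0 a -> slice x h1 a.
Proof.
by move=> H [xa Sa]; split=> // z h xz nza ha; rewrite -H //; apply: Sa.
Qed.

(** Among the vertices of the star of [x] on a geodesic from [y] to [t], one
    that is closest to [y] belongs to the slice: if a neighbour [z] of [x] separated
    it from [y], then the star of [z] would be met before, and as there are no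
    squares and pentagons, the geodesic could be changed to enter the star of [x]
    at [z]. *)
Lemma reroute x y t h0 q : X x -> X y -> X t -> in_copy h0 y -> ~ commute x y ->
  X q -> commute x q -> d y t = d y q + d q t ->
  exists2 a, slice x h0 a & d y t = d y a + d a t.
Proof.
move=> Vx Vy Vt hy nxy Vq xq Eq.
pose Q n := `[< exists a, [/\ X a, commute x a, d y t = d y a + d a t & d y a = n] >].
have exQ : exists n, Q n by exists (d y q); apply/asboolP; exists q.
have [n /asboolP [a [Va xa Ea En]] nmin] := ex_minnP exQ.
have {}nmin b : X b -> commute x b -> d y b + d b t <= d y t -> d y a <= d y b.
  move=> Vb xb le_b; rewrite En; apply: nmin; apply/asboolP; exists b; split => //.
  by apply/eqP; rewrite eqn_leq le_b dD.
exists a => //.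
have nya : y <> a by move=> E; apply: nxy; rewrite E.
(* If [a] were [x], its predecessor on a geodesic from [y] would belong to the star of [x] and be
   closer to [y]. *)
have nxa : x <> a.
  move=> E; have [z zx yz] := d_pred Vy Va nya.
  have za : adj a z by rewrite ext_adj_sym.
  have Vz : X z := adj_vertex za.
  suff : d y a <= d y z by rewrite yz ltnn.
  apply: nmin => //; first by rewrite E; apply: adj_commute.
  by have := dD Vz Va Vt; have := graph_dist_adj zx; lia.
have adj_xa : adj x a by apply/ext_adjP.
split=> // z h xz nza ha; apply: contrapT => ch.
have [p [yp lp] szp] := dP Vy Va; rewrite -lp in ha.
have [b bp zb] := path_commute e_sym e_irr yp hy ha ch; rewrite lp in ha.
have Vb : X b := path_X (@adj_vertex V e) Vy yp bp; have Vz := adj_vertex xz.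
have yab := walk_split (@adj_vertex V e) ext_walk Vy (conj yp lp) szp bp.
have nzac := link_antichain e_sym e_irr e_tri e_sq xz adj_xa nza.
have nba : b <> a by move=> E; apply: nzac; rewrite -E.
have dba : 0 < d b a by rewrite lt0n; apply/eqP => /(d0 Vb Va).
have nxb : ~ commute x b.
  move=> xb; suff : d y a <= d y b by rewrite yab; lia.
  by apply: nmin => //; have := dD Vb Va Vt; lia.
have nzb : z <> b by move=> E; apply: nxb; rewrite -E; apply: adj_commute.
have nbx : b <> x by move=> E; apply: nxb; rewrite E.
have adj_zb : adj z b by apply/ext_adjP.
have d_xa := graph_dist_adj adj_xa; have d_xz := graph_dist_adj xz.
have d_zb := graph_dist_adj adj_zb.
(* The detour from [b] through [z] and [x] to [a] has length at most 3. If [b] were this far from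
   [a], the detour would be geodesic and enter the star of [x] at [z], before [a]. *)
have ba3 : d b a < 3.
  rewrite ltnNge; apply/negP => le3.
  have : d y a <= d y z.
    apply: nmin => //; first exact: adj_commute.
    have := dD Vy Vb Vz; have := dD Vz Vx Vt; have := dD Vx Va Vt.
    by have := dC Vb Vz; have := dC Vx Vz; lia.
  by have := dD Vy Vb Vz; have := dC Vb Vz; lia.

(* Distance 1 gives a square through [x], [z], [b], [a], and distance 2 a pentagon. *)
have [ba1|ba1] := eqVneq (d b a) 1%N.
  apply: nbx; apply: (no_square e_sym e_irr e_tri e_sq xz adj_xa nza Vb).
    exact: commute_sym.
  by apply: adj_commute; apply: d_eq1.
have ba2 : d b a = 2 by lia.
have [c ca] := d_pred Vb Va nba; rewrite ba2 => -[/esym bc].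
have Vc : X c by apply: (@adj_vertex V e a); rewrite ext_adj_sym.
have adj_bc := d_eq1 Vb Vc bc.
apply: (no_pentagon e_sym e_irr e_tri e_sq e_pent xz adj_xa nza adj_zb _ adj_bc nbx).
  by rewrite ext_adj_sym.
by move=> E; apply: nxb; rewrite -E; apply/commute_sym/adj_commute.
Qed.

End Slices.

(** * Dynamics of a loxodromic element *)

Section Dynamics.
Variables (V : finType) (e : rel V).
Hypotheses (e_sym : symmetric e) (e_irr : irreflexive e).

Local Notation G := (raag e).
Local Notation gen := (raag_gen e).
Local Notation evalw := (@evalw V e).
Local Notation letter := (@letter V e).
Local Notation vtx := (@vtx V e).
Local Notation adj := (@ext_adj V e).
Local Notation X := (@ext_vertex V e).
Local Notation d := (graph_dist adj).

Hypothesis (e_conn : forall u v, connect e u v).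

Let ewalk := ext_walk e_irr e_conn.
Let d0 := graph_dist_eq0 ewalk.
Let dC := graph_distC (@ext_adj_sym V e) ewalk.
Let dD := graph_distD ewalk.

Lemma gen_X v : X (gen v).
Proof. by apply/ext_vertexP; exists 1, v; rewrite vtx1. Qed.

Lemma vtx_X h v : X (vtx h v).
Proof. by apply/ext_vertexP; exists h, v. Qed.

Lemma dist_vtx h u v : d (vtx h u) (vtx h v) = d (gen u) (gen v).
Proof. by rewrite /vtx distJ //; apply: gen_X. Qed.

Lemma gen_by_power v (i : int) :
  exists2 s, gen_by (pred1 v) s & cross (gen v) s = i.
Proof.
have pos n : exists2 s, gen_by (pred1 v) s & cross (gen v) s = Posz n.
  elim: n => [|n [s Ss cs]]; first by exists 1; [exact: gen_by1|rewrite cross1].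
  exists (letter (v, true) * s).
    by apply: gen_byM => //; apply: gen_by_letter; rewrite /= eqxx.
  have cv : commute (gen v) (letter (v, true)) by apply: commute_letter.
  by rewrite crossM cross_letter eqxx (conjg_commute cv) cs /= -PoszD add1n.
case: i => n; first exact: pos.
have [s Ss cs] := pos n.+1; exists s^-1; first exact: gen_byV.
have cv : commute (gen v) s by apply: commute_gen_by Ss => _ /eqP ->.
by rewrite crossV (conjg_commute (commuteV cv)) cs NegzE.
Qed.

(** Multiplying [h] on the right by a power of its last letter [v] removes the
    vertex [vtx h v] from the vertices crossed by [h], and moves the copies of the
    vertices by a bounded distance. *)
Lemma dist_crossed v0 : exists C : nat, forall (U : seq G) h,
  (forall x, cross x h <> 0%R -> x \in U) -> d (gen v0) (vtx h v0) <= C * size U.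
Proof.
pose C := (\max_(v : V) d (gen v0) (gen v)).
exists (2 * C)%N => U; have [n] := ubnP (size U); elim: n U => // n IH U Un h HU.
have [->|/eqP h1] := eqVneq h 1; first by rewrite vtx1 graph_distxx.
have [v [b tv]] := top_neq1 e_sym e_irr h1.
have xU := HU _ (cross_top e_sym e_irr tv); set x := vtx h v in xU.
have [s Ss cs] := gen_by_power v (- cross x h)%R.
pose U' := [seq z <- U | z != x].
have szU : size U' < size U.
  rewrite size_filter -(count_predC (pred1 x) U) -[X in X < _]add0n ltn_add2r.
  by rewrite -has_count; apply/hasP; exists x => //=.
have cvs : commute s (gen v) by apply/commute_sym; apply: commute_gen_by Ss => _ /eqP->.
have H' z : cross z (h * s) <> 0%R -> z \in U'.
  rewrite mem_filter => nz; apply/andP; split.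
    by apply/eqP => E; apply: nz; rewrite E crossM vtx_conj cs addrN.
  have [E|/eqP E] := eqVneq (cross (z ^ h) s) 0%R.
    by apply: HU; move: nz; rewrite crossM E addr0.
  have [k [u [kv /eqP -> Ez]]] := cross_gen_by Ss E.
  suff -> : z = x by [].
  rewrite -(conjgK h z) Ez -[k]mul1g vtx_comm ?vtx1 //.
  by apply/commute_sym; apply: commute_gen_by kv => _ /eqP->.
have := IH U' (leq_trans szU Un) (h * s) H'.
have d1 := dD (gen_X v0) (vtx_X (h * s) v0) (vtx_X h v0).
have d2 := dD (vtx_X (h * s) v0) (vtx_X (h * s) v) (vtx_X h v0).
rewrite dist_vtx (vtx_comm h cvs) dist_vtx in d2.
have dv : d (gen v0) (gen v) <= C by apply: (leq_bigmax v).
have Csz : (2 * C * (size U').+1 <= 2 * C * size U)%N by rewrite leq_mul2l szU orbT.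
rewrite mulnS in Csz; rewrite (dC (gen_X v)) in d2; last exact: gen_X.
move=> le_s; apply: leq_trans d1 _; apply: leq_trans Csz; rewrite addnC.
by apply: leq_add le_s; apply: leq_trans d2 _; rewrite mul2n -addnn leq_add.
Qed.

Lemma cross_finite (h : G) : exists K : seq G,
  (forall x, x \in K -> X x) /\ forall x, cross x h <> 0%R -> x \in K.
Proof.
have [w ->] := evalwP h; elim: w => [|l w [K [KX KP]]].
  by exists [::]; split=> // x; rewrite evalw_nil cross1.
exists (gen l.1 :: [seq y ^ (letter l)^-1 | y <- K]); split=> x.
  rewrite inE => /orP[/eqP->|/mapP[y yK ->]]; first exact: gen_X.
  exact/ext_vertexJ/KX.
rewrite evalw_cons crossM cross_letter inE => nz.
have [//|nx] := eqVneq (gen l.1) x; rewrite /=.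
apply/mapP; exists (x ^ letter l); last by rewrite conjgK.
by apply: KP; move: nz; rewrite (negPf nx) add0r.
Qed.

Lemma eventually_all (K : seq G) (Q : G -> nat -> Prop) :
  (forall c, c \in K -> exists M, forall k, M <= k -> Q c k) ->
  exists M, forall c k, c \in K -> M <= k -> Q c k.
Proof.
elim: K => [|c K IH] H; first by exists 0%N.
have [M1 H1] := H c (mem_head _ _).
have [|M2 H2] := IH; first by move=> c' c'K; apply: H; rewrite inE c'K orbT.
exists (maxn M1 M2) => c' k; rewrite inE geq_max => /orP[/eqP->|c'K] /andP[k1 k2].
  exact: H1.
exact: H2.
Qed.

Variable (g : G).
Hypothesis (escape : forall x y B, X x -> X y ->
  exists M, forall k, M <= k -> B < d x (y ^ (g ^+ k))).

Lemma conj_expgS x k : x ^ (g ^+ k.+1) = (x ^ (g ^+ k)) ^ g.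
Proof. by rewrite expgSr conjgM. Qed.

Lemma no_periodic x n : X x -> 0 < n -> x ^ (g ^+ n) <> x.
Proof.
move=> Vx n0 E; have [M /(_ (n * M)%N)] := escape 0%N Vx Vx.
rewrite leq_pmull // => /(_ isT); suff -> : x ^ (g ^+ (n * M)) = x by rewrite graph_distxx.
by rewrite expgnA; elim: M => [|M IH]; rewrite ?conjg1 // expgSr conjgM IH.
Qed.

Lemma not_commute_translate x n : X x -> 0 < n -> ~ commute x (x ^ (g ^+ n)).
Proof.
move=> Vx n0; have := no_periodic Vx n0; have /ext_vertexP [h [v ->]] := Vx.
by rewrite vtx_conjV => n1 c; apply: n1; apply: (vtx_same_label e_sym e_irr c).
Qed.

(** Conjugation by [g] moves copies by [g^-1], so positive powers of [g] stand for the past and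
    negative ones for the future. The step from [g ^+ k] to the next power crosses translates of
    finitely many vertices, and these leave the star of [x]. *)
Lemma cross_past_stable x : X x -> exists M, forall k z, M <= k -> X z -> commute x z ->
  cross z (g ^+ k) = cross z (g ^+ M).
Proof.
move=> Vx; have [K [KX KP]] := cross_finite g.
have [M HM] : exists M, forall c k, c \in K -> M <= k -> 1 < d c (x ^ (g ^+ k)).
  by apply: eventually_all => c /KX Vc; apply: escape.
exists M => k z /subnKC <- Vz xz; elim: (k - M)%N => [|j IH]; first by rewrite addn0.
rewrite addnS expgSr crossM IH; suff -> : cross (z ^ (g ^+ (M + j))) g = 0%R by rewrite addr0.
apply: contrapT => /KP zK; have := HM _ (M + j)%N zK (leq_addr _ _).
rewrite distJ //; suff : d z x <= 1 by lia.
by apply: dist_commute => //; apply: commute_sym.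
Qed.

Lemma cross_future_stable x : X x -> exists M, forall k, M <= k ->
  cross x (g ^- k) = cross x (g ^- M).
Proof.
move=> Vx; have [K [KX KP]] := cross_finite g^-1.
have [M HM] : exists M, forall c k, c \in K -> M <= k -> 0 < d x (c ^ (g ^+ k)).
  by apply: eventually_all => c /KX Vc; apply: escape.
exists M => k /subnKC <-; elim: (k - M)%N => [|j IH]; first by rewrite addn0.
rewrite addnS expgS invgM crossM IH.
suff -> : cross (x ^ (g ^- (M + j))) g^-1 = 0%R by rewrite addr0.
apply: contrapT => /KP xK; have := HM _ (M + j)%N xK (leq_addr _ _).
by rewrite conjgKV graph_distxx.
Qed.

(** Otherwise the element [g ^- n] crosses only vertices that are close to one of
    its ends, so their number is bounded and [dist_crossed] contradicts [escape]. *)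
Lemma separating_vertex (v0 : V) : exists2 x, X x & exists M, forall j k,
  M <= j -> M <= k -> cross x (g ^+ j) <> cross x (g ^- k).
Proof.
apply: contrapT => nosep; have [K [KX KP]] := cross_finite g^-1.
have [M HM] : exists M, forall c k, c \in K -> M <= k ->
    forall j, k <= j -> cross c (g ^+ k) = cross c (g ^- j).
  apply: eventually_all => c cK; have Vc := KX _ cK.
  have [M1 H1] := cross_past_stable Vc; have [M2 H2] := cross_future_stable Vc.
  have E : cross c (g ^+ M1) = cross c (g ^- M2).
    apply: contrapT => n; apply: nosep; exists c => //; exists (maxn M1 M2) => j k.
    by rewrite !geq_max => /andP[j1 _] /andP[_ k2]; rewrite H1 ?H2.
  exists (maxn M1 M2) => k; rewrite geq_max => /andP[k1 k2] j kj.
  by rewrite H1 // E H2 //; apply: leq_trans kj.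
have [C HC] := dist_crossed v0.
(* The crossed vertices will be [c ^ (g ^+ k)] with [c] in [K] and [k] among the first [M] or the
   last [M + 1] exponents up to [n]. *)
have [n0 Hn0] := escape (C * (size K * (M + (M + 1))))%N (gen_X v0) (gen_X v0).
pose n := (n0 + M + M)%N.
pose U := [seq c ^ (g ^+ k) | c <- K, k <- iota 0 M ++ iota (n - M)%N (M + 1)].
have n0n : n0 <= n by rewrite /n -addnA leq_addr.
have := Hn0 n n0n; rewrite ltnNge.
have -> : gen v0 ^ (g ^+ n) = vtx (g ^- n) v0 by rewrite /vtx invgK.
suff HU x : cross x (g ^- n) <> 0%R -> x \in U.
  by move=> /negP; apply; have := HC U _ HU; rewrite size_allpairs size_cat !size_iota.
move=> nz; have [k [c [kn cK Ex]]] : exists k c, [/\ k < n, c \in K & x = c ^ (g ^+ k)].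
  elim: (n) nz => [|j IH]; first by rewrite invg1 cross1.
  rewrite expgS invgM crossM; have [E|/eqP E] := eqVneq (cross (x ^ (g ^- j)) g^-1) 0%R.
    by rewrite E addr0 => /IH [k [c [kj cK Ex]]]; exists k, c; rewrite ltnW.
  by move=> _; exists j, (x ^ (g ^- j)); split => //; [exact: KP|rewrite conjgKV].
rewrite Ex; apply/allpairsP; exists (c, k); split => //=.
rewrite mem_cat !mem_iota /= add0n; case: leqP => //= Mk.
have [nk|nk] := leqP M (n - k)%N; last first.
  by lia.
(* For [k] far from both ends, the number is [cross c (g ^- (n - k)) - cross c (g ^+ k)]; both terms
   have their stable value, and these agree. *)
case: nz; rewrite Ex -(subnKC (ltnW kn)) addnC expgnDr invgM crossM crossV.
rewrite !conjgK (HM c k cK Mk n (ltnW kn)).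
have <- := HM c (n - k)%N cK nk n (leq_subr _ _).
by rewrite (HM c (n - k)%N cK nk _ (leqnn _)) addNr.
Qed.

(** Otherwise, by [cross_nested], all the translates [x ^ (g ^+ n)] with [n > 0]
    would lie on the same side of [x] as the past of [g]. *)
Lemma separates_translate x : X x ->
  (exists M, forall j k, M <= j -> M <= k -> cross x (g ^+ j) <> cross x (g ^- k)) ->
  exists M, forall k h, M <= k -> in_copy h (x ^ g) -> cross x h <> cross x (g ^+ k).
Proof.
move=> Vx [M HM]; have [M1 H1] := cross_past_stable Vx.
exists (maxn M M1) => k h1; rewrite geq_max => /andP[Mk M1k] h1y Eh1.
pose y := x ^ g; rewrite -/y in h1y.
have sep j : M <= j -> cross x (g ^- j) <> cross x h1.
  by move=> Mj; rewrite Eh1; apply/nesym/HM.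
have nxy : ~ commute x y by apply: (@not_commute_translate x 1).
have [hx hxx] := ext_in_copy Vx.
have past n h : in_copy h (x ^ (g ^+ n.+1)) -> cross x h = cross x h1.
  elim: n h => [|n IH] h hz; first exact: cross_const hz h1y nxy.
  (* In the remaining case [y] does not separate [h] from [x]. Translating by [g] and using
     induction puts [g * hx] on the side of [h1]; then [cross_nested] for a copy in the far future
     contradicts [sep]. *)
  case: (cross_nested e_sym e_irr h hxx h1y nxy) => // Eh.
  have gh : in_copy (g * h) (x ^ (g ^+ n.+1)).
    by have := in_copyM g hz; rewrite conj_expgS conjgK.
  have := IH _ gh; rewrite crossM -/y Eh.
  case: (cross_nested e_sym e_irr (g ^- M.+1) hxx h1y nxy) => [/sep|<-].
    by move=> []; apply: leqnSn.
  by rewrite -crossM expgSr invgM mulVKg => /sep; case.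
have [K [KX KP]] := cross_finite hx.
have [M2 HM2] : exists M2, forall c k, c \in K -> M2 <= k -> 0 < d x (c ^ (g ^+ k)).
  by apply: eventually_all => c /KX Vc; apply: escape.
(* So far out, [hx] does not cross [x ^ (g ^- n.+1)]; hence the copy [g ^- n.+1 * hx] of a translate
   lies on the future side of [x], against [past]. *)
pose n := (M + M2)%N.
have hn : in_copy (g ^- n.+1 * hx) (x ^ (g ^+ n.+1)) by apply: in_copyJ.
have := past _ _ hn; rewrite crossM.
suff -> : cross (x ^ (g ^- n.+1)) hx = 0%R.
  by rewrite addr0; apply: sep; rewrite leqW // leq_addr.
apply: contrapT => /KP xK; have := HM2 _ n.+1 xK.
rewrite conjgKV graph_distxx => H; suff : false by []; apply: H.
by rewrite leqW // leq_addl.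
Qed.

Hypotheses (e_tri : forall a b c, e a b -> e b c -> e c a -> False)
  (e_sq : forall a b c d, e a b -> e b c -> e c d -> e d a -> a <> c -> b = d)
  (e_pent : forall a b c d f, e a b -> e b c -> e c d -> e d f -> e f a -> False).

(** This provides the hypothesis [S_slices]. The translate of [x] by [g ^+ k] separates the base
    point from the next translate, so a geodesic to [t] meets its star and can be rerouted through
    its slice; moved back by [g ^- k], this is the slice of [x] seen from the stable past. *)
Lemma slice_step (v0 : V) x M : X x ->
  (forall k h, M <= k -> in_copy h (x ^ g) -> cross x h <> cross x (g ^+ k)) ->
  (forall k z, M <= k -> X z -> commute x z -> cross z (g ^+ k) = cross z (g ^+ M)) ->
  (forall k, M <= k -> 1 < d (gen v0) (x ^ (g ^+ k))) ->
  forall k t, M <= k -> X t -> commute (x ^ (g ^+ k.+1)) t ->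
  exists2 s, slice x (g ^+ M) s &
    d (gen v0) t = d (gen v0) (s ^ (g ^+ k)) + d (s ^ (g ^+ k)) t.
Proof.
move=> Vx sep stab far k t Mk Vt xt; set y := gen v0; set x1 := x ^ (g ^+ k.+1) in xt.
set x0 := x ^ (g ^+ k).
have Vy : X y := gen_X v0; have Vx0 : X x0 := ext_vertexJ _ Vx.
have Vx1 : X x1 := ext_vertexJ _ Vx.
have Ex1 : x1 = x0 ^ g by rewrite /x1 conj_expgS.
have nx01 : ~ commute x0 x1.
  rewrite Ex1; apply: (@not_commute_translate x0 1) => //.
have nx0y : ~ commute x0 y.
  move=> c; have := far k Mk; rewrite -/x0 ltnNge => /negP; apply.
  by apply: dist_commute => //; apply: commute_sym.
have y1 : in_copy 1 y by exists v0; rewrite vtx1.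
have [h hx1] := ext_in_copy Vx1.
have ch : cross x0 1 <> cross x0 h.
  rewrite -(mulVg (g ^+ k)) -[h](mulKg (g ^+ k)) /x0 -[X in _ ^ X]invgK.
  rewrite crossJ_eq; apply: nesym; apply: sep => //.
  by have := in_copyM (g ^+ k) hx1; rewrite /x1 expgS conjgM conjgK.
have [p [yp lp] szp] := graph_distP ewalk Vy Vt.
have [q qp x0q] : exists2 q, q \in y :: p & commute x0 q.
  have [E|/eqP n] := eqVneq x1 t.
    by rewrite E -lp in hx1; apply: (path_commute e_sym e_irr yp y1 hx1 ch).
  (* The geodesic may stop at a neighbour of [x1]; extending it to [x1] makes the separation
     applicable, and the added vertex does not commute with [x0]. *)
  have yp1 : path adj y (rcons p x1).
    rewrite rcons_path yp lp ext_adj_sym; apply/ext_adjP; split=> //.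
  have hx1' : in_copy h (last y (rcons p x1)) by rewrite last_rcons.
  have [q qp x0q] := path_commute e_sym e_irr yp1 y1 hx1' ch.
  exists q => //; move: qp; rewrite -rcons_cons mem_rcons inE => /orP[/eqP E|//].
  by case: nx01; rewrite -E.
have Vq : X q := path_X (@adj_vertex V e) Vy yp qp.
have Eq := walk_split (@adj_vertex V e) ewalk Vy (conj yp lp) szp qp.
have [a Sa Ea] := reroute e_sym e_irr e_conn e_tri e_sq e_pent Vx0 Vy Vt y1 nx0y Vq x0q Eq.
exists (a ^ (g ^- k)); last by rewrite conjgKV.
have := sliceJ (g ^- k) Sa; rewrite invgK mulg1 /x0 conjgK; apply: slice_past => z xz.
by apply: stab => //; [exact: adj_vertex xz|exact: adj_commute xz].
Qed.

Lemma iter_conj n x : iter n (conjg^~ g) x = x ^ (g ^+ n).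
Proof. by elim: n => [|n IH]; rewrite ?conjg1 //= IH -conjgM -expgSr. Qed.

Lemma exists_axis (v0 : V) : exists m s, [/\ 0 < m <= max_degree e
  & on_axis X d (conjg^~ g) m s].
Proof.
have [x Vx sep] := separating_vertex v0.
have [M1 H1] := cross_past_stable Vx; have [M2 H2] := separates_translate Vx sep.
have [M3 H3] := escape 1 (gen_X v0) Vx.
pose M := (M1 + M2 + M3)%N.
have sep' k h : M <= k -> in_copy h (x ^ g) -> cross x h <> cross x (g ^+ k).
  by move=> Mk; apply: H2; rewrite /M in Mk; lia.
have stab k z : M <= k -> X z -> commute x z -> cross z (g ^+ k) = cross z (g ^+ M).
  by move=> Mk Vz xz; rewrite (H1 k) ?(H1 M) //; rewrite /M in Mk *; lia.
have far k : M <= k -> 1 < d (gen v0) (x ^ (g ^+ k)).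
  by move=> Mk; apply: H3; rewrite /M in Mk; lia.
have step := slice_step Vx sep' stab far.
have Sadj s : slice x (g ^+ M) s -> adj x s by case.
have SX s : slice x (g ^+ M) s -> X s by move=> /Sadj; apply: adj_vertex.
apply: (@short_axis _ X d _ dD d0 _ _ _ (slice x (g ^+ M)) _ M (gen v0)) => //.
- by move=> z _; apply: graph_distxx.
- by move=> z; apply: ext_vertexJ.
- by move=> z z'; apply: distJ.
- have Vt := ext_vertexJ (g ^+ M.+1) Vx.
  by have [s Ss _] := step M _ (leqnn M) Vt (commute_refl _); exists s.
- by move=> l ul Sl; apply: (slice_card e_sym e_irr Vx ul Sl).
- by move=> z n Vz n0; rewrite iter_conj; apply: no_periodic.
- exact: gen_X.
move=> k s Mk Ss; rewrite iter_conj.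
have [||s' Ss' E] := step k (s ^ (g ^+ k.+1)) Mk.
- exact/ext_vertexJ/SX.
- exact/commuteJ/adj_commute/Sadj.
by exists s'; rewrite ?iter_conj.
Qed.

End Dynamics.

(** * Linear growth and escape for loxodromic elements *)

Section Loxodromic.
Variables (R : realType) (V : finType) (e : rel V).
Hypotheses (e_sym : symmetric e) (e_irr : irreflexive e).
Hypothesis (e_conn : forall u v, connect e u v).

Local Notation G := (raag e).
Local Notation adj := (@ext_adj V e).
Local Notation X := (@ext_vertex V e).
Local Notation d := (graph_dist adj).

Let ewalk := ext_walk e_irr e_conn.
Let dC := graph_distC (@ext_adj_sym V e) ewalk.
Let dD := graph_distD ewalk.

Lemma ext_dist_nat (x y : G) : X x -> X y -> ext_dist R x y = ((d x y)%:R%R)%:E.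
Proof. exact: gdist_graph_dist. Qed.

Lemma loxodromic_linear (g : G) : loxodromic R g ->
  exists2 x, X x & exists K, forall n, n <= K * d x (x ^ (g ^+ n)).
Proof.
move=> [x Vx tl]; exists x => //; apply: contrapT => nK.
pose D n := d x (x ^ (g ^+ n)).
have Vg n : X (x ^ (g ^+ n)) by apply: ext_vertexJ.
have D_sub m n : D (m + n)%N <= D m + D n.
  rewrite /D expgnDr conjgM addnC.
  apply: leq_trans (dD Vx (Vg n) (ext_vertexJ _ (Vg m))) _.
  by rewrite leq_add2l distJ.
have DK K : exists n, K * D n < n.
  apply: contrapT => nn; apply: nK; exists K => n; rewrite leqNgt.
  by apply/negP => lt_n; apply: nn; exists n.
have D0 := @subadditive_mean_cvg0 R D D_sub DK.
move: tl; rewrite /translation_length.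
have -> : (fun n => ext_dist R x (x ^ (g ^+ n)) * (n%:R^-1)%R%:E)%E =
    (fun n => ((D n)%:R / n%:R)%R%:E).
  by apply/funext => n; rewrite ext_dist_nat.
have -> : limn (fun n => ((D n)%:R / n%:R : R)%R%:E) = 0%E.
  apply: cvg_lim; first exact: ereal_hausdorff.
  by apply: cvg_EFin => //; apply: nearW.
by rewrite ltxx.
Qed.

Lemma loxodromic_escape (g : G) : loxodromic R g -> forall x y B, X x -> X y ->
  exists M, forall k, M <= k -> B < d x (y ^ (g ^+ k)).
Proof.
move=> /loxodromic_linear [z Vz [K HK]] x y B Vx Vy.
exists (K * (d z x + B + d y z)).+1 => k Mk; rewrite ltnNge; apply/negP => le_B.
move: Mk; rewrite ltnNge => /negP; apply; apply: leq_trans (HK k) _.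
rewrite leq_mul2l; apply/orP; right.
have Vyk := ext_vertexJ (g ^+ k) Vy; have Vzk := ext_vertexJ (g ^+ k) Vz.
apply: leq_trans (dD Vz Vyk Vzk) _; rewrite distJ // leq_add2r.
by apply: leq_trans (dD Vz Vx Vyk) _; rewrite leq_add2l.
Qed.

End Loxodromic.

Theorem corollary5p6 (R : realType) (V : finType) (e : rel V) (N : nat) :
  simplicial e ->
  connected_graph e ->
  ((6%:R)%R%:E <= girth R e)%E ->
  N = max_degree e ->
  forall g : raag e, loxodromic R g ->
  exists (m : nat) (L : 'I_m -> set (raag e)),
    [/\ (1 <= m <= N)%N,
        forall i : 'I_m, bi_infinite_geodesic R (L i),
        forall i j : 'I_m, i <> j -> (L i `&` L j)%classic = set0
      & cyclically_permutes g L].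
Proof.
move=> [e_sym e_irr] [/card_gt0P [v0 _] e_conn] e_girth -> g g_lox.
have escape := loxodromic_escape e_irr e_conn g_lox.
have axis := exists_axis e_sym e_irr e_conn escape (girth_triangle e_irr e_girth)
  (girth_square e_irr e_girth) (girth_pentagon e_irr e_girth) v0.
have ewalk := ext_walk e_irr e_conn.
have geo := graph_geodesic (@adj_vertex V e) ewalk.
have dxx (x : raag e) : ext_vertex x -> graph_dist (@ext_adj V e) x x = 0%N.
  by move=> _; apply: graph_distxx.
have [m [t [l [mN Xl dl lt l_disj]]]] := disjoint_axes dxx
  (graph_distC (@ext_adj_sym V e) ewalk) (graph_distD ewalk) geo (conjgK g) (conjgKV g)
  (fun x => @ext_vertexJ V e x g) (fun x => @ext_vertexJ V e x g^-1)
  (fun x y => @distJ V e e_irr e_conn x y g) axis.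
have iterX k i : ext_vertex (iter k (conjg^~ g) (l i)) by apply: X_iter => // x; apply: ext_vertexJ.
exists m, (fun k => range (fun i => iter k (conjg^~ g) (l i))); split=> //.
- move=> k; exists (fun i => iter k (conjg^~ g) (l i)); split=> // i j.
  rewrite ext_dist_nat // (d_iter (X := @ext_vertex V e)) //; last first.
    by move=> x y; apply: distJ.
    by move=> x; apply: ext_vertexJ.
  by rewrite dl natr_absz.
- have meet (j k : 'I_m) i i' : j < k ->
      iter j (conjg^~ g) (l i) <> iter k (conjg^~ g) (l i').
    move=> jk E; have /l_disj : 0 < k - j < m.
      by rewrite subn_gt0 jk /=; apply: leq_ltn_trans (leq_subr _ _) (ltn_ord k).
    move=> /(_ i' i); apply; apply: (can_inj (iterK (conjgK g) j)).
    by rewrite -iterD subnKC // ltnW.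
  move=> j k njk; rewrite -subset0 => x /= [[i _ <-] [i' _]].
  have [jk|kj|/val_inj//] := ltngtP j k; last exact: meet.
  by move=> /esym; apply: meet.
move=> k; have [km|mk] := ltnP k.+1 m.
  by rewrite /ordS /= modn_small // image_comp.
have Ek : k.+1 = m by apply/eqP; rewrite eqn_leq mk andbT.
(* At the last index the cyclic successor is 0: the power [g ^+ m] maps the line [l] to itself,
   shifted by [t]. *)
have step i : iter k (conjg^~ g) (l i) ^ g = l (i + t)%R.
  by rewrite -lt -[in RHS]Ek.
rewrite /ordS /= Ek modnn; apply/seteqP; split=> [_ [_ [i _ <-] <-]|_ [i _ <-]] /=.
  by exists (i + t)%R; rewrite ?step.
by exists (iter k (conjg^~ g) (l (i - t)%R)); [exists (i - t)%R|rewrite step subrK].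
Qed.
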